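(* Let $(\mathcal B,\mathbb E,\mathfrak s)$ be an extriangulated category with enough projectives and enough injectives, with subcategory of projectives $\mathcal P$, let $n\ge2$ be an integer, and let $\mathcal M\subseteq\mathcal B$ be an $n$-cluster tilting subcategory. Then the cotorsion pairs $(\mathcal M_1,\mathcal Y_1),\ldots,(\mathcal M_{n-1},\mathcal Y_{n-1})$ are mutually heart-equivalent, and their hearts are equivalent to $\mathrm{mod}(\mathcal M/\mathcal P)$.
   Context: Extriangulated category $(\mathcal B,\mathbb E,\mathfrak s)$: (ET1) $\mathcal B$ is an additive category and $\mathbb E\colon\mathcal B^{\mathrm{op}}\times\mathcal B\to \mathrm{Ab}$ is an additive bifunctor; for $\delta\in\mathbb E(C,A)$, $a\colon A\to A'$, $c\colon C'\to C$ write $a_*\delta=\mathbb E(C,a)(\delta)$ and $c^*\delta=\mathbb E(c,A)(\delta)$. Sequences $A\to B\to C$ and $A\to B'\to C$ are equivalent if there is an isomorphism $B\cong B'$ compatible with the identities of $A$ and $C$. $\mathfrak s$ assigns to each $\delta\in\mathbb E(C,A)$ an equivalence class $\mathfrak s(\delta)=[A\xrightarrow{x}B\xrightarrow{y}C]$; we say $A\xrightarrow{x}B\xrightarrow{y}C$ realizes $\delta$. (ET2) $\mathfrak s$ is an additive realization: if $A\xrightarrow{x}B\xrightarrow{y}C$ realizes $\delta$, $A'\xrightarrow{x'}B'\xrightarrow{y'}C'$ realizes $\delta'$ and $a\colon A\to A'$, $c\colon C\to C'$ satisfy $a_*\delta=c^*\delta'$, then there is $b\colon B\to B'$ with $bx=x'a$,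 $y'b=cy$; $0\in\mathbb E(C,A)$ is realized by the split sequence $A\to A\oplus C\to C$; and $\mathfrak s(\delta\oplus\delta')=\mathfrak s(\delta)\oplus\mathfrak s(\delta')$. (ET3) If $A\xrightarrow{x}B\xrightarrow{y}C$ realizes $\delta\in\mathbb E(C,A)$, $A'\xrightarrow{x'}B'\xrightarrow{y'}C'$ realizes $\delta'\in\mathbb E(C',A')$ and $a\colon A\to A'$, $b\colon B\to B'$ satisfy $bx=x'a$, then there is $c\colon C\to C'$ with $cy=y'b$ and $a_*\delta=c^*\delta'$; and (ET3)$^{\mathrm{op}}$, its dual. (ET4) If $\delta\in\mathbb E(D,A)$ and $\delta'\in\mathbb E(F,B)$ are realized by $A\xrightarrow{f}B\xrightarrow{f'}D$ and $B\xrightarrow{g}C\xrightarrow{g'}F$, there are an object $E$, morphisms $d\colon D\to E$, $e\colon E\to F$, $h'\colon C\to E$ with $h'g=df'$, $eh'=g'$, and $\delta''\in\mathbb E(E,A)$ realized by $A\xrightarrow{gf}C\xrightarrow{h'}E$, such that $D\xrightarrow{d}E\xrightarrow{e}F$ realizes $f'_*\delta'$, $d^*\delta''=\delta$ and $f_*\delta''=e^*\delta'$; and (ET4)$^{\mathrm{op}}$, its dual. A conflation $A\overset{x}{\rightarrowtail}B\overset{y}{\twoheadrightarrow}C$ is a sequence realizing some $\delta\in\mathbb E(C,A)$; then $x$ is an inflation and $y$ a deflation. An object $P$ is projective if $\mathbb E(P,\mathcal B)=0$ and $I$ is injective if $\mathbb E(\mathcal B,I)=0$; $\mathcal P$, $\mathcal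 I$ are the full subcategories of projectives and injectives. $\mathcal B$ has enough projectives (injectives) if every $B$ admits a deflation $P\to B$ with $P\in\mathcal P$ (an inflation $B\to I$ with $I\in\mathcal I$). For full subcategories $\mathcal X,\mathcal Y\subseteq\mathcal B$: $\mathrm{Cone}(\mathcal X,\mathcal Y)$ is the full subcategory of objects $B$ admitting a conflation $X\rightarrowtail Y\twoheadrightarrow B$, and $\mathrm{CoCone}(\mathcal X,\mathcal Y)$ that of objects $B$ admitting a conflation $B\rightarrowtail X\twoheadrightarrow Y$, with $X\in\mathcal X$, $Y\in\mathcal Y$. A cotorsion pair $(\mathcal U,\mathcal V)$ on $\mathcal B$ is a pair of full additive subcategories closed under direct summands and isomorphisms with $\mathbb E(\mathcal U,\mathcal V)=0$ and such that every $B\in\mathcal B$ admits conflations $V_B\rightarrowtail U_B\twoheadrightarrow B$ and $B\rightarrowtail V^B\twoheadrightarrow U^B$ with $U_B,U^B\in\mathcal U$, $V_B,V^B\in\mathcal V$. Put $\mathcal W=\mathcal U\cap\mathcal V$, $\mathcal B^+=\mathrm{Cone}(\mathcal V,\mathcal W)$, $\mathcal B^-=\mathrm{CoCone}(\mathcal W,\mathcal U)$, $\mathcal H=\mathcal B^+\cap\mathcal B^-$, $\underline{\mathcal B}=\mathcal B/\mathcal W$ (ideal quotient by morphisms factoring through $\mathcal W$; $\underline f$ is the image of $f$), $\underline{\mathcal B}^{\pm}=\mathcal B^{\pm}/\mathcal W$. The heart is $\underline{\mathcal H}=\mathcal H/\mathcal W$, which is an abelian category. A reflection sequence for $B$ is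 a conflation $B\overset{z}{\rightarrowtail}Z\twoheadrightarrow U$ with $Z\in\mathcal B^+$, $U\in\mathcal U$ such that $z^*\colon\mathbb E(Z,V)\to\mathbb E(B,V)$ is surjective for all $V\in\mathcal V$. A coreflection sequence for $B$ is a conflation $V\rightarrowtail X\overset{x}{\twoheadrightarrow}B$ with $X\in\mathcal B^-$, $V\in\mathcal V$ such that $x_*\colon\mathbb E(U,X)\to\mathbb E(U,B)$ is surjective for all $U\in\mathcal U$. Every object has both. For each $B$ choose a reflection sequence $B\overset{p_B}{\rightarrowtail}B^+\twoheadrightarrow U$ and a coreflection sequence $V\rightarrowtail B^-\overset{m_B}{\twoheadrightarrow}B$ (with $B^{\pm}=B$ and identity map if $B\in\mathcal B^{\pm}$). The functor $\sigma^+\colon\underline{\mathcal B}\to\underline{\mathcal B}^+$ is $B\mapsto B^+$, with $\sigma^+(\underline f)$ for $f\colon B\to C$ the unique morphism satisfying $\sigma^+(\underline f)\,\underline{p_B}=\underline{p_C}\,\underline f$; dually $\sigma^-\colon\underline{\mathcal B}\to\underline{\mathcal B}^-$ is $B\mapsto B^-$, with $\underline{m_C}\,\sigma^-(\underline f)=\underline f\,\underline{m_B}$. With $\pi\colon\mathcal B\to\underline{\mathcal B}$ the quotient functor, $H=\sigma^-\circ\sigma^+\circ\pi\colon\mathcal B\to\underline{\mathcal H}$. Two cotorsion pairs with hearts $\underline{\mathcal H},\underline{\mathcal H}'$ and functors $H,H'$ are heart-equivalent if there is an equivalence $E\colon\underline{\mathcal H}\to\underline{\mathcal H}'$ with $E\circ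 H\cong H'$. Cosyzygies of subcategories: $\Sigma^0\mathcal X=\mathcal X$, $\Sigma^i\mathcal X=\mathrm{Cone}(\Sigma^{i-1}\mathcal X,\mathcal I)$ for $i>0$. For an object $X$ choose conflations $\Sigma^iX\rightarrowtail I^i\twoheadrightarrow\Sigma^{i+1}X$ with $I^i\in\mathcal I$ and $\Omega^{i+1}X\rightarrowtail P_i\twoheadrightarrow\Omega^iX$ with $P_i\in\mathcal P$ ($\Sigma^0X=\Omega^0X=X$). Higher extensions: $\mathbb E^{i+1}(X,Y)=\mathbb E(X,\Sigma^iY)\cong\mathbb E(\Omega^iX,Y)$ for $i\ge0$. A full subcategory $\mathcal M\subseteq\mathcal B$ is $n$-cluster tilting if (1) it is contravariantly finite and covariantly finite in $\mathcal B$; (2) $X\in\mathcal M$ iff $\mathbb E^i(X,\mathcal M)=0$ for all $1\le i\le n-1$; (3) $X\in\mathcal M$ iff $\mathbb E^i(\mathcal M,X)=0$ for all $1\le i\le n-1$. Define $\mathcal M_1=\mathcal M$, $\mathcal M_\ell=\mathrm{Cone}(\mathcal M_{\ell-1},\mathcal M)$ for $\ell>1$, and $\mathcal Y_\ell=\Sigma^{\ell-1}\mathcal M_{n-\ell}$ for $1\le\ell\le n-1$; each $(\mathcal M_\ell,\mathcal Y_\ell)$, $1\le\ell\le n-1$, is a cotorsion pair. For an additive category $\mathcal A$, $\mathrm{mod}(\mathcal A)$ denotes the category of coherent functors: additive functors $F\colon\mathcal A^{\mathrm{op}}\to\mathrm{Ab}$ admitting an exact sequence $\mathcal A(-,A_1)\to\mathcal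 A(-,A_0)\to F\to0$ with $A_0,A_1\in\mathcal A$. $\mathcal M/\mathcal P$ is the ideal quotient. *)

(* Defs.v *)
From HB Require Import structures.
From mathcomp Require Import all_boot all_algebra.
From mathcomp Require Import boolp.

Set Implicit Arguments.
Unset Strict Implicit.
Unset Printing Implicit Defensive.

Import GRing.Theory.
Local Open Scope ring_scope.
Local Open Scope quotient_scope.

(* Plain categories carry no group structure on their Hom types, so that
   categories of functors with values in abelian groups are also instances. *)
Record category := Category {
  cob : Type;
  chom : cob -> cob -> Type;
  cid : forall X, chom X X;
  ccomp : forall X Y Z, chom Y Z -> chom X Y -> chom X Z;
  ccompA : forall X Y Z T (h : chom Z T) (g : chom Y Z) (f : chom X Y),
    ccomp h (ccomp g f) = ccomp (ccomp h g) f;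
  ccomp1f : forall X Y (f : chom X Y), ccomp (cid Y) f = f;
  ccompf1 : forall X Y (f : chom X Y), ccomp f (cid X) = f }.
Arguments cid {c} X.
Arguments ccomp {c X Y Z} _ _.

Definition cat_iso (C : category) (X Y : cob C) (f : chom X Y) : Prop :=
  exists g : chom Y X, ccomp g f = cid X /\ ccomp f g = cid Y.

Record functor (C D : category) := Functor {
  fun_ob :> cob C -> cob D;
  fun_map : forall X Y, chom X Y -> chom (fun_ob X) (fun_ob Y);
  fun_map1 : forall X, fun_map (cid X) = cid (fun_ob X);
  fun_mapM : forall X Y Z (g : chom Y Z) (f : chom X Y),
    fun_map (ccomp g f) = ccomp (fun_map g) (fun_map f) }.
Arguments fun_map {C D} _ {X Y} _.

Definition fid (C : category) : functor C C :=
  @Functor C C id (fun _ _ f => f) (fun _ => erefl) (fun _ _ _ _ _ => erefl).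

Section FunctorComposition.
Variables (C D E : category) (G : functor D E) (F : functor C D).

Lemma fcomp_map1 (X : cob C) : fun_map G (fun_map F (cid X)) = cid (G (F X)).
Proof. by rewrite !fun_map1. Qed.

Lemma fcomp_mapM (X Y Z : cob C) (g : chom Y Z) (f : chom X Y) :
  fun_map G (fun_map F (ccomp g f)) =
  ccomp (fun_map G (fun_map F g)) (fun_map G (fun_map F f)).
Proof. by rewrite !fun_mapM. Qed.

Definition fcomp : functor C E :=
  @Functor C E (fun X => G (F X)) (fun _ _ f => fun_map G (fun_map F f))
    fcomp_map1 fcomp_mapM.
End FunctorComposition.

Definition nat_iso (C D : category) (F G : functor C D) : Prop :=
  exists eta : forall X : cob C, chom (F X) (G X),
    (forall X, cat_iso (eta X)) /\
    (forall X Y (f : chom X Y),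
       ccomp (eta Y) (fun_map F f) = ccomp (fun_map G f) (eta X)).

Definition is_equivalence (C D : category) (F : functor C D) : Prop :=
  exists G : functor D C, nat_iso (fcomp G F) (fid C) /\ nat_iso (fcomp F G) (fid D).

Definition equivalent (C D : category) : Prop :=
  exists F : functor C D, is_equivalence F.

Record preadditive := Preadditive {
  ob : Type;
  hom : ob -> ob -> zmodType;
  idm : forall X, hom X X;
  comp : forall X Y Z, hom Y Z -> hom X Y -> hom X Z;
  compA : forall X Y Z T (h : hom Z T) (g : hom Y Z) (f : hom X Y),
    comp h (comp g f) = comp (comp h g) f;
  comp1f : forall X Y (f : hom X Y), comp (idm Y) f = f;
  compf1 : forall X Y (f : hom X Y), comp f (idm X) = f;
  compDl : forall X Y Z (g g' : hom Y Z) (f : hom X Y),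
    comp (g + g') f = comp g f + comp g' f;
  compDr : forall X Y Z (g : hom Y Z) (f f' : hom X Y),
    comp g (f + f') = comp g f + comp g f' }.
Arguments idm {p} X.
Arguments comp {p X Y Z} _ _.

Notation "g ∘ f" := (comp g f) (at level 40, left associativity).

Definition cat_of (C : preadditive) : category :=
  @Category (ob C) (fun X Y => hom X Y) (fun X => idm X)
    (fun _ _ _ g f => g ∘ f) (@compA C) (@comp1f C) (@compf1 C).
Coercion cat_of : preadditive >-> category.

Definition isom (C : preadditive) (X Y : ob C) (f : hom X Y) : Prop :=
  exists g : hom Y X, g ∘ f = idm X /\ f ∘ g = idm Y.

(* A full subcategory is given by the predicate of its objects. *)
Definition fullsub (C : preadditive) (P : ob C -> Prop) : preadditive :=
  @Preadditive {X : ob C | P X} (fun X Y => hom (sval X) (sval Y))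
    (fun X => idm (sval X)) (fun _ _ _ g f => g ∘ f)
    (fun _ _ _ _ h g f => compA h g f) (fun _ _ f => comp1f f)
    (fun _ _ f => compf1 f) (fun _ _ _ g g' f => compDl g g' f)
    (fun _ _ _ g f f' => compDr g f f').

Definition fullsub_incl (C : preadditive) (P : ob C -> Prop) :
    functor (fullsub P) C :=
  @Functor (fullsub P) C (fun X => sval X) (fun _ _ f => f)
    (fun _ => erefl) (fun _ _ _ _ _ => erefl).

Section PreadditiveTheory.
Variable C : preadditive.

Lemma comp0f (X Y Z : ob C) (f : hom X Y) : (0 : hom Y Z) ∘ f = 0.
Proof. by apply: (addrI (0 ∘ f)); rewrite -compDl !addr0. Qed.

Lemma compf0 (X Y Z : ob C) (g : hom Y Z) : g ∘ (0 : hom X Y) = 0.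
Proof. by apply: (addrI (g ∘ 0)); rewrite -compDr !addr0. Qed.

Lemma compNl (X Y Z : ob C) (g : hom Y Z) (f : hom X Y) : (- g) ∘ f = - (g ∘ f).
Proof. by apply: (addrI (g ∘ f)); rewrite -compDl !subrr comp0f. Qed.

Lemma compNr (X Y Z : ob C) (g : hom Y Z) (f : hom X Y) : g ∘ (- f) = - (g ∘ f).
Proof. by apply: (addrI (g ∘ f)); rewrite -compDr !subrr compf0. Qed.

Lemma compBl (X Y Z : ob C) (g g' : hom Y Z) (f : hom X Y) :
  (g - g') ∘ f = g ∘ f - g' ∘ f.
Proof. by rewrite compDl compNl. Qed.

Lemma compBr (X Y Z : ob C) (g : hom Y Z) (f f' : hom X Y) :
  g ∘ (f - f') = g ∘ f - g ∘ f'.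
Proof. by rewrite compDr compNr. Qed.

End PreadditiveTheory.

Section IdealQuotient.
Variables (C : preadditive) (W : ob C -> Prop).

Definition factors (X Y : ob C) (f : hom X Y) : Prop :=
  exists Z (h : hom Z Y) (g : hom X Z), W Z /\ f = h ∘ g.

(* The ideal generated by the morphisms factoring through W; it consists of
   exactly these morphisms when W is additive, see [in_idealP] below. *)
Inductive in_ideal (X Y : ob C) : hom X Y -> Prop :=
| in_ideal0 : in_ideal 0
| in_ideal_factors f : factors f -> in_ideal f
| in_idealB f g : in_ideal f -> in_ideal g -> in_ideal (f - g).

Lemma in_ideal_comp (X Y Z T : ob C) (h : hom Z T) (f : hom Y Z) (g : hom X Y) :
  in_ideal f -> in_ideal (h ∘ f ∘ g).
Proof.
elim=> [|{}f [V [k [l [WV ->]]]]|f1 f2 _ IH1 _ IH2].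
- by rewrite compf0 comp0f; apply: in_ideal0.
- apply: in_ideal_factors; exists V, (h ∘ k), (l ∘ g).
  by split=> //; rewrite !compA.
- by rewrite compBr compBl; apply: in_idealB.
Qed.

Definition ideal (X Y : ob C) : {pred hom X Y} := fun f => `[< in_ideal f >].

Lemma ideal_zmod_closed (X Y : ob C) : zmod_closed (@ideal X Y).
Proof.
split; first exact/asboolP/in_ideal0.
by move=> f g /asboolP If /asboolP Ig; apply/asboolP/in_idealB.
Qed.

HB.instance Definition _ (X Y : ob C) :=
  GRing.isZmodClosed.Build (hom X Y) (@ideal X Y) (@ideal_zmod_closed X Y).

Definition qhom (X Y : ob C) : zmodType := Quotient.quot (@ideal X Y).

Definition qpi (X Y : ob C) (f : hom X Y) : qhom X Y := \pi_(Quotient.quot (@ideal X Y)) f.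

Lemma qpi_eq (X Y : ob C) (f g : hom X Y) : (qpi f = qpi g) <-> in_ideal (f - g).
Proof.
split=> [/eqP|H]; first by rewrite -[_ == _]Quotient.idealrBE => /asboolP.
by apply/eqP; rewrite -[_ == _]Quotient.idealrBE; apply/asboolP.
Qed.

Lemma qpi_repr (X Y : ob C) (f : qhom X Y) : qpi (repr f) = f.
Proof. exact: reprK. Qed.

Lemma qpiD (X Y : ob C) (f g : hom X Y) : qpi (f + g) = qpi f + qpi g.
Proof. exact: (raddfD (\pi_(Quotient.quot (@ideal X Y)))). Qed.

Definition qcomp (X Y Z : ob C) (g : qhom Y Z) (f : qhom X Y) : qhom X Z :=
  qpi (repr g ∘ repr f).

Lemma qpi_comp (X Y Z : ob C) (g : hom Y Z) (f : hom X Y) :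
  qpi (g ∘ f) = qcomp (qpi g) (qpi f).
Proof.
apply/qpi_eq.
set g' := repr _; set f' := repr _.
have /qpi_eq Ig : qpi g = qpi g' by rewrite qpi_repr.
have /qpi_eq If : qpi f = qpi f' by rewrite qpi_repr.
have -> : g ∘ f - g' ∘ f' = idm Z ∘ (g - g') ∘ f - (g' ∘ (f' - f) ∘ idm X).
  by rewrite comp1f compf1 compBl compBr opprB addrA subrK.
apply: in_idealB; apply: in_ideal_comp => //.
by rewrite -opprB -[- _]add0r; apply: in_idealB => //; apply: in_ideal0.
Qed.

Lemma qcompA X Y Z T (h : qhom Z T) (g : qhom Y Z) (f : qhom X Y) :
  qcomp h (qcomp g f) = qcomp (qcomp h g) f.
Proof.
by rewrite -[h]qpi_repr -[g]qpi_repr -[f]qpi_repr -!qpi_comp compA.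
Qed.

Lemma qcomp1f X Y (f : qhom X Y) : qcomp (qpi (idm Y)) f = f.
Proof. by rewrite -[f]qpi_repr -qpi_comp comp1f. Qed.

Lemma qcompf1 X Y (f : qhom X Y) : qcomp f (qpi (idm X)) = f.
Proof. by rewrite -[f]qpi_repr -qpi_comp compf1. Qed.

Lemma qcompDl X Y Z (g g' : qhom Y Z) (f : qhom X Y) :
  qcomp (g + g') f = qcomp g f + qcomp g' f.
Proof.
rewrite -[g]qpi_repr -[g']qpi_repr -[f]qpi_repr.
by rewrite -qpiD -!qpi_comp -qpiD compDl.
Qed.

Lemma qcompDr X Y Z (g : qhom Y Z) (f f' : qhom X Y) :
  qcomp g (f + f') = qcomp g f + qcomp g f'.
Proof.
rewrite -[g]qpi_repr -[f]qpi_repr -[f']qpi_repr.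
by rewrite -qpiD -!qpi_comp -qpiD compDr.
Qed.

Definition quotient : preadditive :=
  @Preadditive (ob C) qhom (fun X => qpi (idm X)) qcomp
    qcompA qcomp1f qcompf1 qcompDl qcompDr.

Definition quotient_fun : functor C quotient :=
  @Functor C quotient id qpi (fun _ => erefl) qpi_comp.

End IdealQuotient.

(* The ideal quotient X/W, as a full subcategory of C/W; it is the quotient of
   X by the morphisms factoring through W because W is contained in X wherever
   this is used. *)
Definition subquotient (C : preadditive) (X W : ob C -> Prop) : preadditive :=
  @fullsub (quotient W) X.

Record abfun (A : preadditive) := Abfun {
  af_ob :> ob A -> zmodType;
  af_map : forall X Y, hom X Y -> af_ob Y -> af_ob X;
  af_mapD : forall X Y (f : hom X Y) (s t : af_ob Y),
    af_map f (s + t) = af_map f s + af_map f t;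
  af_map1 : forall X (s : af_ob X), af_map (idm X) s = s;
  af_mapM : forall X Y Z (g : hom Y Z) (f : hom X Y) (s : af_ob Z),
    af_map (g ∘ f) s = af_map f (af_map g s);
  af_add : forall X Y (f g : hom X Y) (s : af_ob Y),
    af_map (f + g) s = af_map f s + af_map g s }.
Arguments af_map {A} _ {X Y} _ _.

Record abtrans (A : preadditive) (F G : abfun A) := Abtrans {
  at_comp :> forall X : ob A, F X -> G X;
  at_compD : forall X (s t : F X), at_comp (s + t) = at_comp s + at_comp t;
  at_nat : forall X Y (f : hom X Y) (s : F Y),
    at_comp (af_map F f s) = af_map G f (at_comp s) }.

Definition yoneda (A : preadditive) (Z : ob A) : abfun A :=
  @Abfun A (fun X => hom X Z) (fun _ _ f s => s ∘ f)
    (fun _ _ f s t => compDl s t f) (fun _ s => compf1 s)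
    (fun _ _ _ g f s => compA s g f) (fun _ _ f g s => compDr s f g).

(* Exactness of A(-,A1) -> A(-,A0) -> F -> 0, objectwise. *)
Definition coherent (A : preadditive) (F : abfun A) : Prop :=
  exists (A1 A0 : ob A) (a : abtrans (yoneda A1) (yoneda A0))
         (p : abtrans (yoneda A0) F),
    forall X : ob A,
      (forall s : F X, exists t, p X t = s) /\
      (forall t : yoneda A0 X, p X t = 0 <-> exists r, a X r = t).

Section CoherentCategory.
Variable A : preadditive.
Implicit Types F G K L : abfun A.

Lemma abtrans_eq F G (u v : abtrans F G) :
  (forall X s, u X s = v X s) -> u = v.
Proof.
case: u v => [u uD un] [v vD vn] /= uv.
have {}uv : u = v by apply: functional_extensionality_dep => X; apply: funext.
by case: v / uv vD vn => vD vn; congr Abtrans; apply: Prop_irrelevance.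
Qed.

Definition abid F : abtrans F F :=
  @Abtrans A F F (fun _ s => s) (fun _ _ _ => erefl) (fun _ _ _ _ => erefl).

Section Comp.
Variables (F G K : abfun A) (v : abtrans G K) (u : abtrans F G).

Lemma abcompD X (s t : F X) : v X (u X (s + t)) = v X (u X s) + v X (u X t).
Proof. by rewrite !at_compD. Qed.

Lemma abcomp_nat X Y (f : hom X Y) (s : F Y) :
  v X (u X (af_map F f s)) = af_map K f (v Y (u Y s)).
Proof. by rewrite !at_nat. Qed.

Definition abcomp : abtrans F K :=
  @Abtrans A F K (fun X s => v X (u X s)) abcompD abcomp_nat.
End Comp.

Lemma abcompA F G K L (w : abtrans K L) (v : abtrans G K) (u : abtrans F G) :
  abcomp w (abcomp v u) = abcomp (abcomp w v) u.
Proof. exact: abtrans_eq. Qed.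

Lemma abcomp1f F G (u : abtrans F G) : abcomp (abid G) u = u.
Proof. exact: abtrans_eq. Qed.

Lemma abcompf1 F G (u : abtrans F G) : abcomp u (abid F) = u.
Proof. exact: abtrans_eq. Qed.

Definition mod_cat : category :=
  @Category {F : abfun A | coherent F} (fun X Y => abtrans (sval X) (sval Y))
    (fun X => abid (sval X)) (fun _ _ _ v u => abcomp v u)
    (fun _ _ _ _ w v u => abcompA w v u)
    (fun _ _ u => abcomp1f u) (fun _ _ u => abcompf1 u).

End CoherentCategory.

Record additive_cat := AdditiveCat {
  acat :> preadditive;
  zob : ob acat;
  zobP : idm zob = 0;
  bsum : ob acat -> ob acat -> ob acat;
  bi1 : forall X Y, hom X (bsum X Y);
  bi2 : forall X Y, hom Y (bsum X Y);
  bp1 : forall X Y, hom (bsum X Y) X;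
  bp2 : forall X Y, hom (bsum X Y) Y;
  bp1i1 : forall X Y, bp1 X Y ∘ bi1 X Y = idm X;
  bp2i2 : forall X Y, bp2 X Y ∘ bi2 X Y = idm Y;
  bp1i2 : forall X Y, bp1 X Y ∘ bi2 X Y = 0;
  bp2i1 : forall X Y, bp2 X Y ∘ bi1 X Y = 0;
  bsumP : forall X Y, bi1 X Y ∘ bp1 X Y + bi2 X Y ∘ bp2 X Y = idm (bsum X Y) }.
Arguments zob {a}.
Arguments bsum {a} X Y.
Arguments bi1 {a} X Y.
Arguments bi2 {a} X Y.
Arguments bp1 {a} X Y.
Arguments bp2 {a} X Y.

Definition msum (B : additive_cat) (X X' Y Y' : ob B)
    (f : hom X Y) (f' : hom X' Y') : hom (bsum X X') (bsum Y Y') :=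
  bi1 Y Y' ∘ f ∘ bp1 X X' + bi2 Y Y' ∘ f' ∘ bp2 X X'.

Definition additive_sub (B : additive_cat) (X : ob B -> Prop) : Prop :=
  X zob /\ forall A A', X A -> X A' -> X (bsum A A').

Definition iso_closed (B : additive_cat) (X : ob B -> Prop) : Prop :=
  forall A A' (f : hom A A'), isom f -> X A -> X A'.

Definition summand_closed (B : additive_cat) (X : ob B -> Prop) : Prop :=
  forall A A', X (bsum A A') -> X A /\ X A'.

Lemma in_idealP (B : additive_cat) (W : ob B -> Prop) (X Y : ob B) (f : hom X Y) :
  additive_sub W -> in_ideal W f <-> factors W f.
Proof.
move=> [W0 WD]; split; last exact: in_ideal_factors.
elim=> [|//|f1 f2 _ [Z [h [g [WZ ->]]]] _ [Z' [h' [g' [WZ' ->]]]]].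
  by exists zob, 0, 0; rewrite comp0f.
exists (bsum Z Z'), (h ∘ bp1 Z Z' - h' ∘ bp2 Z Z'), (bi1 Z Z' ∘ g + bi2 Z Z' ∘ g').
split; first exact: WD.
rewrite compBl !compDr !compA -!(compA h) -!(compA h').
by rewrite bp1i1 bp1i2 bp2i1 bp2i2 !comp1f !comp0f !compf0 addr0 add0r.
Qed.

(* [ext C A] is E(C,A), contravariant in C and covariant in A; [push a d] is
   a_* d and [pull c d] is c^* d. *)
Record additive_bifunctor (B : additive_cat) := AdditiveBifunctor {
  ext : ob B -> ob B -> zmodType;
  push : forall C A A', hom A A' -> ext C A -> ext C A';
  pull : forall C C' A, hom C' C -> ext C A -> ext C' A;
  pushD : forall C A A' (a : hom A A') (d d' : ext C A),
    push a (d + d') = push a d + push a d';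
  pullD : forall C C' A (c : hom C' C) (d d' : ext C A),
    pull c (d + d') = pull c d + pull c d';
  push1 : forall C A (d : ext C A), push (idm A) d = d;
  pull1 : forall C A (d : ext C A), pull (idm C) d = d;
  pushM : forall C A A' A'' (a' : hom A' A'') (a : hom A A') (d : ext C A),
    push (a' ∘ a) d = push a' (push a d);
  pullM : forall C C' C'' A (c : hom C' C) (c' : hom C'' C') (d : ext C A),
    pull (c ∘ c') d = pull c' (pull c d);
  push_pull : forall C C' A A' (a : hom A A') (c : hom C' C) (d : ext C A),
    push a (pull c d) = pull c (push a d);
  push_add : forall C A A' (a a' : hom A A') (d : ext C A),
    push (a + a') d = push a d + push a' d;
  pull_add : forall C C' A (c c' : hom C' C) (d : ext C A),
    pull (c + c') d = pull c d + pull c' d }.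
Arguments push {B a0} {C A A'} _ _ : rename.
Arguments pull {B a} {C C' A} _ _ : rename.

Definition seq_equiv (B : additive_cat) (A M M' C : ob B)
    (x : hom A M) (y : hom M C) (x' : hom A M') (y' : hom M' C) : Prop :=
  exists b : hom M M', isom b /\ b ∘ x = x' /\ y' ∘ b = y.

Definition ext_sum (B : additive_cat) (EE : additive_bifunctor B)
    (C A C' A' : ob B) (d : ext EE C A) (d' : ext EE C' A') :
    ext EE (bsum C C') (bsum A A') :=
  push (bi1 A A') (pull (bp1 C C') d) + push (bi2 A A') (pull (bp2 C C') d').

(* [realizes x y d] means that s(d) is the equivalence class of A -x-> M -y-> C;
   by [real_ex] and [real_class] the sequences realizing d form exactly one
   equivalence class. *)
Record extriangulated := Extriangulated {
  xcat :> additive_cat;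
  xext : additive_bifunctor xcat;
  realizes : forall A M C : ob xcat, hom A M -> hom M C -> ext xext C A -> Prop;
  real_ex : forall C A (d : ext xext C A),
    exists M (x : hom A M) (y : hom M C), realizes x y d;
  real_class : forall A M M' C (x : hom A M) (y : hom M C)
      (x' : hom A M') (y' : hom M' C) (d : ext xext C A),
    realizes x y d -> (realizes x' y' d <-> seq_equiv x y x' y');
  et2_mor : forall A M C A' M' C' (x : hom A M) (y : hom M C)
      (x' : hom A' M') (y' : hom M' C') (d : ext xext C A) (d' : ext xext C' A')
      (a : hom A A') (c : hom C C'),
    realizes x y d -> realizes x' y' d' -> push a d = pull c d' ->
    exists b : hom M M', b ∘ x = x' ∘ a /\ y' ∘ b = c ∘ y;
  et2_split : forall A C, realizes (bi1 A C) (bp2 A C) (0 : ext xext C A);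
  et2_sum : forall A M C A' M' C' (x : hom A M) (y : hom M C)
      (x' : hom A' M') (y' : hom M' C') (d : ext xext C A) (d' : ext xext C' A'),
    realizes x y d -> realizes x' y' d' ->
    realizes (msum x x') (msum y y') (ext_sum d d');
  et3 : forall A M C A' M' C' (x : hom A M) (y : hom M C)
      (x' : hom A' M') (y' : hom M' C') (d : ext xext C A) (d' : ext xext C' A')
      (a : hom A A') (b : hom M M'),
    realizes x y d -> realizes x' y' d' -> b ∘ x = x' ∘ a ->
    exists c : hom C C', c ∘ y = y' ∘ b /\ push a d = pull c d';
  et3op : forall A M C A' M' C' (x : hom A M) (y : hom M C)
      (x' : hom A' M') (y' : hom M' C') (d : ext xext C A) (d' : ext xext C' A')
      (b : hom M M') (c : hom C C'),
    realizes x y d -> realizes x' y' d' -> c ∘ y = y' ∘ b ->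
    exists a : hom A A', b ∘ x = x' ∘ a /\ push a d = pull c d';
  et4 : forall A B D C F (f : hom A B) (f' : hom B D) (g : hom B C) (g' : hom C F)
      (d1 : ext xext D A) (d2 : ext xext F B),
    realizes f f' d1 -> realizes g g' d2 ->
    exists (E : ob xcat) (d : hom D E) (e : hom E F) (h' : hom C E)
           (d3 : ext xext E A),
      [/\ h' ∘ g = d ∘ f' /\ e ∘ h' = g',
          realizes (g ∘ f) h' d3,
          realizes d e (push f' d2),
          pull d d3 = d1
        & push f d3 = pull e d2];
  et4op : forall A B D C F (f' : hom D B) (f : hom B A) (g' : hom F C) (g : hom C B)
      (d1 : ext xext A D) (d2 : ext xext B F),
    realizes f' f d1 -> realizes g' g d2 ->
    exists (E : ob xcat) (d : hom E D) (e : hom F E) (h' : hom E C)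
           (d3 : ext xext A E),
      [/\ g ∘ h' = f' ∘ d /\ h' ∘ e = g',
          realizes h' (f ∘ g) d3,
          realizes e d (pull f' d2),
          push d d3 = d1
        & pull f d3 = push e d2] }.
Arguments realizes {e A M C} _ _ _.

Section Extriangulated.
Variable B : extriangulated.
Local Notation subcat := (ob B -> Prop).
Local Notation EE := (ext (xext B)).

Definition conflation (A M C : ob B) (x : hom A M) (y : hom M C) : Prop :=
  exists d : EE C A, realizes x y d.

Definition projective : subcat := fun P => forall (A : ob B) (d : EE P A), d = 0.
Definition injective_ob : subcat := fun I => forall (C : ob B) (d : EE C I), d = 0.

Definition enough_projectives : Prop :=
  forall A : ob B, exists (P K : ob B) (x : hom K P) (y : hom P A),
    projective P /\ conflation x y.
Definition enough_injectives : Prop :=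
  forall A : ob B, exists (I C : ob B) (x : hom A I) (y : hom I C),
    injective_ob I /\ conflation x y.

Definition Cone (X Y : subcat) : subcat := fun A =>
  exists (X0 Y0 : ob B) (x : hom X0 Y0) (y : hom Y0 A),
    [/\ X X0, Y Y0 & conflation x y].
Definition CoCone (X Y : subcat) : subcat := fun A =>
  exists (X0 Y0 : ob B) (x : hom A X0) (y : hom X0 Y0),
    [/\ X X0, Y Y0 & conflation x y].

Record cotorsion_pair (U V : subcat) : Prop := CotorsionPair {
  cp_addU : additive_sub U;
  cp_addV : additive_sub V;
  cp_isoU : iso_closed U;
  cp_isoV : iso_closed V;
  cp_summandU : summand_closed U;
  cp_summandV : summand_closed V;
  cp_ext0 : forall (X Y : ob B) (d : EE X Y), U X -> V Y -> d = 0;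
  cp_left : forall A : ob B, exists (VA UA : ob B) (x : hom VA UA) (y : hom UA A),
    [/\ V VA, U UA & conflation x y];
  cp_right : forall A : ob B, exists (VA UA : ob B) (x : hom A VA) (y : hom VA UA),
    [/\ V VA, U UA & conflation x y] }.

Section Heart.
Variables U V : subcat.

Definition W_of : subcat := fun X => U X /\ V X.
Definition Bplus : subcat := Cone V W_of.
Definition Bminus : subcat := CoCone W_of U.
Definition heart_ob : subcat := fun X => Bplus X /\ Bminus X.

Definition stable : preadditive := quotient W_of.
Definition stable_plus : preadditive := subquotient Bplus W_of.
Definition stable_minus : preadditive := subquotient Bminus W_of.
Definition heart : preadditive := subquotient heart_ob W_of.

Definition reflection_sequence (A Z U0 : ob B) (z : hom A Z) (u : hom Z U0) : Prop :=
  [/\ Bplus Z, U U0, conflation z u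
    & forall V0, V V0 -> forall d : EE A V0, exists d' : EE Z V0, pull z d' = d].

Definition coreflection_sequence (V0 X A : ob B) (v : hom V0 X) (x : hom X A) : Prop :=
  [/\ Bminus X, V V0, conflation v x
    & forall U0, U U0 -> forall d : EE U0 A, exists d' : EE U0 X, push x d' = d].

(* [S] is sigma^+ for the choice [p] of reflection sequences: A^+ is the object
   [sval (S A)] and [p A] the inflation A -> A^+.  The equality of dependent
   pairs says that A^+ = A and p A is the identity when A lies in B^+. *)
Record sigma_plus_spec (S : functor stable stable_plus)
    (p : forall A : ob B, @hom B A (sval (S A))) : Prop := SigmaPlusSpec {
  sp_seq : forall A, exists (U0 : ob B) (u : @hom B (sval (S A)) U0),
    reflection_sequence (p A) u;
  sp_id : forall A, Bplus A ->
    existT (fun Z => @hom B A Z : Type) (sval (S A)) (p A) = existT _ A (idm A);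
  sp_map : forall (A C : ob B) (f : @hom stable A C),
    unique (fun g : @hom stable (sval (S A)) (sval (S C)) =>
              g ∘ (qpi W_of (p A) : @hom stable A (sval (S A))) =
              (qpi W_of (p C) : @hom stable C (sval (S C))) ∘ f)
           (fun_map S f) }.

Record sigma_minus_spec (S : functor stable stable_minus)
    (m : forall A : ob B, @hom B (sval (S A)) A) : Prop := SigmaMinusSpec {
  sm_seq : forall A, exists (V0 : ob B) (v : @hom B V0 (sval (S A))),
    coreflection_sequence v (m A);
  sm_id : forall A, Bminus A ->
    existT (fun X => @hom B X A : Type) (sval (S A)) (m A) = existT _ A (idm A);
  sm_map : forall (A C : ob B) (f : @hom stable A C),
    unique (fun g : @hom stable (sval (S A)) (sval (S C)) =>
              (qpi W_of (m C) : @hom stable (sval (S C)) C) ∘ g =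
              f ∘ (qpi W_of (m A) : @hom stable (sval (S A)) A))
           (fun_map S f) }.

(* H is sigma^- o sigma^+ o pi for some choice of reflection and coreflection
   sequences; the equality is one of functors with values in the stable category. *)
Definition heart_functor (H : functor B heart) : Prop :=
  exists (Sp : functor stable stable_plus) p (Sm : functor stable stable_minus) m,
    [/\ @sigma_plus_spec Sp p, @sigma_minus_spec Sm m
      & fcomp (@fullsub_incl stable heart_ob) H =
        fcomp (@fullsub_incl stable Bminus)
          (fcomp Sm (fcomp (@fullsub_incl stable Bplus)
            (fcomp Sp (quotient_fun W_of))))].

End Heart.

(* H depends on choices, so it is required to exist and the condition is
   imposed for all choices. *)
Definition heart_equivalent (U V U' V' : subcat) : Prop :=
  [/\ exists H, @heart_functor U V H,
      exists H', @heart_functor U' V' H'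
    & forall (H : functor B (heart U V)) (H' : functor B (heart U' V')),
        heart_functor H -> heart_functor H' ->
        exists E : functor (heart U V) (heart U' V'),
          is_equivalence E /\ nat_iso (fcomp E H) H'].

(* [Sig i X] is a choice of the i-th cosyzygy of X. *)
Definition cosyzygy_choice (Sig : nat -> ob B -> ob B) : Prop :=
  (forall X, Sig 0%N X = X) /\
  (forall i X, exists (I : ob B) (x : hom (Sig i X) I) (y : hom I (Sig i.+1 X)),
     injective_ob I /\ conflation x y).

(* E^i(X,Y), for i >= 1. *)
Definition Ext (Sig : nat -> ob B -> ob B) (i : nat) (X Y : ob B) : zmodType :=
  EE X (Sig i.-1 Y).

Definition contravariantly_finite (M : subcat) : Prop :=
  forall A : ob B, exists (M0 : ob B) (f : hom M0 A),
    M M0 /\ forall M1 (g : hom M1 A), M M1 -> exists h : hom M1 M0, g = f ∘ h.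

Definition covariantly_finite (M : subcat) : Prop :=
  forall A : ob B, exists (M0 : ob B) (f : hom A M0),
    M M0 /\ forall M1 (g : hom A M1), M M1 -> exists h : hom M0 M1, g = h ∘ f.

Record cluster_tilting (Sig : nat -> ob B -> ob B) (n : nat) (M : subcat) : Prop :=
  ClusterTilting {
  ct_contra : contravariantly_finite M;
  ct_cov : covariantly_finite M;
  ct_left : forall X : ob B, M X <->
    forall M0 i, M M0 -> (1 <= i <= n - 1)%N -> forall d : Ext Sig i X M0, d = 0;
  ct_right : forall X : ob B, M X <->
    forall M0 i, M M0 -> (1 <= i <= n - 1)%N -> forall d : Ext Sig i M0 X, d = 0 }.

Fixpoint Sigma_sub (i : nat) (X : subcat) : subcat :=
  if i is j.+1 then Cone (Sigma_sub j X) injective_ob else X.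

(* M_l for l >= 1; the value at l = 0 is irrelevant. *)
Definition M_sub (M : subcat) (l : nat) : subcat :=
  iter l.-1 (fun X => Cone X M) M.

Definition Y_sub (M : subcat) (n l : nat) : subcat :=
  Sigma_sub l.-1 (M_sub M (n - l)).

End Extriangulated.

(* Main.v *)
From Pilot Require Import Defs.
From mathcomp Require Import all_boot all_algebra.
From mathcomp Require Import boolp.
Import Pilot.Defs.

(* Write E for the extension bifunctor.  On every heart the functor
   X |-> E(-,X)|_M with values in mod(M/P) is an equivalence, and it turns the
   reflections and coreflections defining H into isomorphisms, hence carries
   H X to E(-,X)|_M naturally in X.  So each H is determined up to
   equivalence by the same functor X |-> E(-,X)|_M.

   Full faithfulness on the heart of (U,V) = (M_l,Y_l): every U0 in U is the
   target of a deflation M0 -> U0 with kernel in U, and morphisms from U to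
   B^+ factor through W, so an element of E(U0,Y) with Y in B^+ vanishes as
   soon as its pullbacks to M do.  Applied to X >-> W0 ->> U0 this shows that
   f : X -> Y killed by the functor extends over W0, and that a natural
   transformation, evaluated at a generator of E(-,X)|_M, comes from some f.
   Density: if K -> P ->> M0 realizes k with P projective and f : M1 -> M0,
   then the middle term X of a realization of f^* k presents coker f.

   That (M_l,Y_l) is a cotorsion pair comes from the descriptions of M_l, and
   of the cosyzygies of the M_k, as right orthogonals of higher extensions,
   which make both classes closed under summands. *)

Set Implicit Arguments.
Unset Strict Implicit.
Unset Printing Implicit Defensive.
Import GRing.Theory.
Local Open Scope ring_scope.

(** * The opposite extriangulated category *)

Definition op_preadditive (C : preadditive) : preadditive :=
  @Preadditive (ob C) (fun X Y => hom Y X) (fun X => idm X)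
    (fun _ _ _ g f => f ∘ g) (fun _ _ _ _ h g f => esym (compA f g h))
    (fun _ _ f => compf1 f) (fun _ _ f => comp1f f)
    (fun _ _ _ g g' f => compDr f g g') (fun _ _ _ g f f' => compDl f f' g).

Definition op_additive (B : additive_cat) : additive_cat :=
  @AdditiveCat (op_preadditive B) zob (zobP B) bsum
    (fun X Y => bp1 X Y) (fun X Y => bp2 X Y) (fun X Y => bi1 X Y) (fun X Y => bi2 X Y)
    (@bp1i1 B) (@bp2i2 B) (@bp2i1 B) (@bp1i2 B) (@bsumP B).

Definition op_ext (B : additive_cat) (E : additive_bifunctor B) :
    additive_bifunctor (op_additive B) :=
  @AdditiveBifunctor (op_additive B) (fun C A => ext E A C)
    (fun _ _ _ a d => pull (a : @hom B _ _) d)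
    (fun _ _ _ c d => push (c : @hom B _ _) d)
    (fun _ _ _ a => @pullD B E _ _ _ a) (fun _ _ _ c => @pushD B E _ _ _ c)
    (fun _ _ => @pull1 B E _ _) (fun _ _ => @push1 B E _ _)
    (fun _ _ _ _ a' a d => @pullM B E _ _ _ _ a a' d)
    (fun _ _ _ _ c c' d => @pushM B E _ _ _ _ c' c d)
    (fun _ _ _ _ a c d => esym (@push_pull B E _ _ _ _ c a d))
    (fun _ _ _ a a' => @pull_add B E _ _ _ a a')
    (fun _ _ _ c c' => @push_add B E _ _ _ c c').

Section Opposite.
Variable B : extriangulated.
Local Notation EE := (ext (xext B)).

Lemma realizes_equiv (A M M' C : ob B) (x : hom A M) (y : hom M C) (d : EE C A)
    (b : hom M M') (b' : hom M' M) :
  b' ∘ b = idm M -> b ∘ b' = idm M' -> realizes x y d -> realizes (b ∘ x) (y ∘ b') d.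
Proof.
move=> b'b bb' rd; apply/(real_class _ _ rd); exists b; split; first by exists b'.
by split=> //; rewrite -compA b'b compf1.
Qed.

(** Dualizing [et2_split] exchanges the two summands, so the dual axiom calls for the split sequence
    with its terms swapped. *)
Lemma split_swap (A C : ob B) : realizes (bi2 C A) (bp1 C A) (0 : EE C A).
Proof.
pose b := bi1 C A ∘ bp2 A C + bi2 C A ∘ bp1 A C.
pose b' := bi1 A C ∘ bp2 C A + bi2 A C ∘ bp1 C A.
have b'b : b' ∘ b = idm (bsum A C).
  rewrite /b /b' compDl !compDr -!compA !(compA (bp2 _ _)) !(compA (bp1 _ _)).
  by rewrite bp1i1 bp1i2 bp2i1 bp2i2 !comp1f !comp0f !compf0 add0r addr0 bsumP.
have bb' : b ∘ b' = idm (bsum C A).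
  rewrite /b /b' compDl !compDr -!compA !(compA (bp2 _ _)) !(compA (bp1 _ _)).
  by rewrite bp1i1 bp1i2 bp2i1 bp2i2 !comp1f !comp0f !compf0 add0r addr0 bsumP.
have := realizes_equiv b'b bb' (et2_split A C).
rewrite /b /b' compDl compDr -!compA bp2i1 bp1i1 !compA bp2i1 bp2i2.
by rewrite compf0 compf1 comp0f comp1f !add0r.
Qed.

Lemma op_real_class (A M M' C : ob (op_additive B)) (x : hom A M) (y : hom M C)
    (x' : hom A M') (y' : hom M' C) (d : ext (op_ext (xext B)) C A) :
  @realizes B _ _ _ y x d -> (@realizes B _ _ _ y' x' d <-> seq_equiv x y x' y').
Proof.
move=> rd; apply: iff_trans (real_class _ _ rd) _; split.
  case=> b [[b' [b'b bb']] /= [<- <-]]; exists b'; split; first by exists b.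
  by rewrite /= -compA bb' compf1 compA b'b comp1f.
case=> b [[b' /= [b'b bb']] [<- <-]]; exists b'; split; first by exists b.
by rewrite /= -compA b'b compf1 compA bb' comp1f.
Qed.

Lemma op_et2_mor (A M C A' M' C' : ob (op_additive B)) (x : hom A M) (y : hom M C)
    (x' : hom A' M') (y' : hom M' C') (d : ext (op_ext (xext B)) C A)
    (d' : ext (op_ext (xext B)) C' A') (a : hom A A') (c : hom C C') :
  @realizes B _ _ _ y x d -> @realizes B _ _ _ y' x' d' -> push a d = pull c d' ->
  exists b : hom M M', b ∘ x = x' ∘ a /\ y' ∘ b = c ∘ y.
Proof.
move=> rd rd' /= e; have [b [/= b1 b2]] := et2_mor rd' rd (esym e).
by exists b.
Qed.

Lemma op_et2_sum (A M C A' M' C' : ob (op_additive B)) (x : hom A M) (y : hom M C)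
    (x' : hom A' M') (y' : hom M' C') (d : ext (op_ext (xext B)) C A)
    (d' : ext (op_ext (xext B)) C' A') :
  @realizes B _ _ _ y x d -> @realizes B _ _ _ y' x' d' ->
  @realizes B _ _ _ (msum y y') (msum x x') (ext_sum d d').
Proof.
move=> rd rd'; have := et2_sum rd rd'.
by rewrite /ext_sum /msum /= !compA !push_pull.
Qed.

Lemma op_et3 (A M C A' M' C' : ob (op_additive B)) (x : hom A M) (y : hom M C)
    (x' : hom A' M') (y' : hom M' C') (d : ext (op_ext (xext B)) C A)
    (d' : ext (op_ext (xext B)) C' A') (a : hom A A') (b : hom M M') :
  @realizes B _ _ _ y x d -> @realizes B _ _ _ y' x' d' -> b ∘ x = x' ∘ a ->
  exists c : hom C C', c ∘ y = y' ∘ b /\ push a d = pull c d'.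
Proof.
move=> rd rd' /= e; have [c [/= c1 c2]] := et3op rd' rd (esym e).
by exists c.
Qed.

Lemma op_et3op (A M C A' M' C' : ob (op_additive B)) (x : hom A M) (y : hom M C)
    (x' : hom A' M') (y' : hom M' C') (d : ext (op_ext (xext B)) C A)
    (d' : ext (op_ext (xext B)) C' A') (b : hom M M') (c : hom C C') :
  @realizes B _ _ _ y x d -> @realizes B _ _ _ y' x' d' -> c ∘ y = y' ∘ b ->
  exists a : hom A A', b ∘ x = x' ∘ a /\ push a d = pull c d'.
Proof.
move=> rd rd' /= e; have [a [/= a1 a2]] := et3 rd' rd (esym e).
by exists a.
Qed.

(** [push] and [pull] trade places by definition, so a lemma instantiated at [B^op] is its dual up
    to conversion. *)
Definition op_extriangulated : extriangulated :=
  @Extriangulated (op_additive B) (op_ext (xext B))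
    (fun A M C x y d => @realizes B C M A y x d)
    (fun C A d => let: ex_intro M (ex_intro x (ex_intro y r)) := real_ex d in
       ex_intro _ M (ex_intro _ y (ex_intro _ x r)))
    op_real_class op_et2_mor (fun A C => split_swap C A) op_et2_sum op_et3 op_et3op
    (fun A M D C F f f' g g' d1 d2 r1 r2 => et4op r1 r2)
    (fun A M D C F f f' g g' d1 d2 r1 r2 => et4 r1 r2).

End Opposite.
Notation "B ^op" := (op_extriangulated B) (at level 2, format "B ^op").

(** * Exact sequences attached to a conflation *)

Section Exactness.
Variable B : extriangulated.
Local Notation EE := (ext (xext B)).
Implicit Types A C K L M P T X Y Z : ob B.

Lemma push0 C A A' (d : EE C A) : push (0 : hom A A') d = 0.
Proof. by apply: (addrI (push 0 d)); rewrite -push_add !addr0. Qed.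

Lemma pushr0 C A A' (a : hom A A') : push a (0 : EE C A) = 0.
Proof. by apply: (addrI (push a 0)); rewrite -pushD !addr0. Qed.

Lemma zob_hom X (f : hom X zob) : f = 0.
Proof. by rewrite -[f]comp1f zobP comp0f. Qed.

(** Comparing a conflation with this trivial one turns (ET3) and its dual into exactness
    statements. *)
Lemma realizes_id0 X : realizes (idm X) (0 : hom X zob) (0 : EE zob X).
Proof.
have e : idm (bsum X zob) = bi1 X zob ∘ bp1 X zob.
  by rewrite -[LHS]bsumP [bp2 X zob]zob_hom compf0 addr0.
have := realizes_equiv (b := bp1 X zob) (b' := bi1 X zob) (esym e) (bp1i1 X zob)
  (et2_split X zob).
by rewrite bp1i1 bp2i1.
Qed.

Section Conflation.
Variables (A M C : ob B) (x : hom A M) (y : hom M C) (d : EE C A).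
Hypothesis rd : realizes x y d.

Lemma conf_kernel X (g : hom X M) : y ∘ g = 0 -> exists h, g = x ∘ h.
Proof.
move=> yg; have e : (0 : hom zob C) ∘ (0 : hom X zob) = y ∘ g by rewrite yg comp0f.
by have [a [e' _]] := et3op (realizes_id0 X) rd e; exists a; rewrite -e' compf1.
Qed.

Lemma conf_push0 : push x d = 0.
Proof.
have [c [_ ->]] := et3 rd (realizes_id0 M) (erefl (idm M ∘ x)).
by apply: (addrI (pull c 0)); rewrite -pullD !addr0.
Qed.

(** If [pull t d] vanishes, the split sequence realizes it and maps to the given conflation over
    [t]; restrict this map to the summand [X]. *)
Lemma pull0_lift X (t : hom X C) : pull t d = 0 -> exists s, t = y ∘ s.
Proof.
move=> td; have e : push (idm A) (0 : EE X A) = pull t d by rewrite push1.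
have [b [_ yb]] := et2_mor (et2_split A X) rd e.
by exists (b ∘ bi2 A X); rewrite compA yb -compA bp2i2 compf1.
Qed.
End Conflation.
End Exactness.

Section ExactnessDual.
Variable B : extriangulated.
Local Notation EE := (ext (xext B)).
Implicit Types A C K L M P T X Y Z : ob B.

Lemma pull0 C C' A (d : EE C A) : pull (0 : hom C' C) d = 0.
Proof. exact: (@push0 B^op). Qed.

Lemma pullr0 C C' A (c : hom C' C) : pull c (0 : EE C A) = 0.
Proof. exact: (@pushr0 B^op). Qed.

Lemma push_sub C A A' (a a' : hom A A') (d : EE C A) :
  push (a - a') d = push a d - push a' d.
Proof. by apply: (addIr (push a' d)); rewrite -push_add !subrK. Qed.

Lemma pull_sub C C' A (c c' : hom C' C) (d : EE C A) :
  pull (c - c') d = pull c d - pull c' d.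
Proof. by apply: (addIr (pull c' d)); rewrite -pull_add !subrK. Qed.

Lemma realizes_0id X : realizes (0 : hom zob X) (idm X) (0 : EE X zob).
Proof. exact: (@realizes_id0 B^op). Qed.

Section Conflation.
Variables (A M C : ob B) (x : hom A M) (y : hom M C) (d : EE C A).
Hypothesis rd : realizes x y d.

Lemma conf_cokernel X (g : hom M X) : g ∘ x = 0 -> exists h, g = h ∘ y.
Proof. exact: (@conf_kernel B^op C M A y x d rd). Qed.

Lemma conf_pull0 : pull y d = 0.
Proof. exact: (@conf_push0 B^op C M A y x d rd). Qed.

Lemma push0_extend X (f : hom A X) : push f d = 0 -> exists g, f = g ∘ x.
Proof. exact: (@pull0_lift B^op C M A y x d rd). Qed.

Lemma push0_pull X (e : EE X A) : push x e = 0 -> exists t, e = pull t d.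
Proof.
move=> xe; have [T [a [b re]]] := real_ex e.
(* As [push x e] is zero, [x] extends over the inflation of [e], and (ET3) then produces [t]. *)
have [g xga] := @pull0_lift B^op _ _ _ _ _ _ re _ x xe.
have [t [_ et]] := et3 re rd (etrans (esym xga) (esym (compf1 x))).
by exists t; rewrite -et push1.
Qed.

Lemma push_exact X (e : EE X M) : push y e = 0 -> exists e', e = push x e'.
Proof.
move=> ye; have [T [a [b re]]] := real_ex e.
(* (ET4) gives C >-> E ->> X of class [push y e], which splits; [d3] pulled back along a section is
   the preimage of [e]. *)
have [E [f [g [h [d3 [[_ _] _ rE _ ed3]]]]]] := et4 rd re.
rewrite ye in rE; have [s gs] := pull0_lift rE (pullr0 _ (idm X)).
by exists (pull s d3); rewrite push_pull ed3 -pullM -gs pull1.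
Qed.
End Conflation.
End ExactnessDual.

Section ExactnessDual2.
Variable B : extriangulated.
Local Notation EE := (ext (xext B)).
Variables (A M C : ob B) (x : hom A M) (y : hom M C) (d : EE C A).
Hypothesis rd : realizes x y d.

Lemma pull0_push X (e : EE C X) : pull y e = 0 -> exists t, e = push t d.
Proof. exact: (@push0_pull B^op C M A y x d rd). Qed.

Lemma pull_exact X (e : EE M X) : pull x e = 0 -> exists e', e = pull y e'.
Proof. exact: (@push_exact B^op C M A y x d rd). Qed.

Lemma pull_lift X (s : hom X M) : pull (y ∘ s) d = 0.
Proof. by rewrite pullM (conf_pull0 rd) pullr0. Qed.

End ExactnessDual2.

(** * Isomorphisms, pullbacks and pushouts of conflations *)

Section Isomorphisms.
Variable B : extriangulated.
Local Notation EE := (ext (xext B)).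
Implicit Types A C K L M P T X Y Z : ob B.

Lemma isom_of_left_right X Y (f : hom X Y) (g h : hom Y X) :
  isom (g ∘ f) -> isom (f ∘ h) -> isom f.
Proof.
case=> k [kgf _] [l [_ fhl]]; exists (k ∘ g); split; first by rewrite -compA.
have e : k ∘ g = h ∘ l.
  transitivity (k ∘ (g ∘ f) ∘ (h ∘ l)); last by rewrite kgf comp1f.
  by rewrite -(compA k) -(compA g) (compA f h) fhl compf1.
by rewrite e compA.
Qed.

(* [idm - u] squares to zero. *)
Lemma conf_endo_isom A M C (x : hom A M) (y : hom M C) (d : EE C A) (u : hom M M) :
  realizes x y d -> u ∘ x = x -> y ∘ u = y -> isom u.
Proof.
move=> rd ux yu.
have [h eh] : exists h, idm M - u = h ∘ y.
  by apply: (conf_cokernel rd); rewrite compBl comp1f ux subrr.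
have nn : (idm M - u) ∘ (idm M - u) = 0.
  by rewrite {1}eh -compA compBr compf1 yu subrr compf0.
have eu : u = idm M - (idm M - u) by rewrite opprB addrC subrK.
set n := idm M - u in nn eu; exists (idm M + n); rewrite eu; split.
  by rewrite compBr compf1 compDl comp1f nn addr0 addrK.
by rewrite compDr compf1 compBl comp1f nn subr0 subrK.
Qed.

(** Some sequence realizes the new class; (ET2) maps it to and from the given one, and both
    composites fix the ends, hence are isomorphisms by [conf_endo_isom]. *)
Lemma realizes_iso_right A M C C' (x : hom A M) (y : hom M C) (d : EE C A)
    (b : hom C C') (b' : hom C' C) :
  b' ∘ b = idm C -> b ∘ b' = idm C' -> realizes x y d ->
  realizes x (b ∘ y) (pull b' d).
Proof.
move=> b'b bb' rd; have [M1 [x1 [y1 r1]]] := real_ex (pull b' d).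
have [f [fx yf]] := et2_mor r1 rd (push1 _).
have [g [gx yg]] : exists g : hom M M1, g ∘ x = x1 ∘ idm A /\ y1 ∘ g = b ∘ y.
  by apply: (et2_mor rd r1); rewrite push1 -pullM b'b pull1.
rewrite !compf1 in fx gx.
apply/(real_class _ _ r1); exists f; split; last first.
  by split=> //; rewrite -compA yf compA bb' comp1f.
apply: (isom_of_left_right (g := g) (h := g)).
  by apply: (conf_endo_isom r1); rewrite -?compA ?fx // compA yg -compA yf compA bb' comp1f.
by apply: (conf_endo_isom rd); rewrite -?compA ?gx // compA yf -compA yg compA b'b comp1f.
Qed.

Lemma realizes_0_isom A M C (x : hom A M) (y : hom M C) :
  realizes x y (0 : EE C A) -> exists b : hom (bsum A C) M, isom b.
Proof. by move=> r; have [b [ib _]] := iffLR (real_class _ _ (et2_split A C)) r; exists b. Qed.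

Lemma split_section A M C (x : hom A M) (y : hom M C) :
  realizes x y (0 : EE C A) -> exists s, y ∘ s = idm C.
Proof. by move=> r; have [s ->] := pull0_lift r (pullr0 _ (idm C)); exists s. Qed.

Lemma split_retraction A M C (x : hom A M) (y : hom M C) :
  realizes x y (0 : EE C A) ->
  exists (r : hom M A) (c : hom C M), r ∘ x = idm A /\ realizes c r 0.
Proof.
move=> r; have [b [[b' [b'b bb']] [<- _]]] := iffLR (real_class _ _ (et2_split A C)) r.
exists (bp1 A C ∘ b'), (b ∘ bi2 A C); split; first by rewrite -compA (compA b') b'b comp1f bp1i1.
exact: realizes_equiv (split_swap C A).
Qed.

Lemma realizes_unique A M M' C (x : hom A M) (y : hom M C) (x' : hom A M')
    (y' : hom M' C) (d : EE C A) :
  realizes x y d -> realizes x' y' d -> exists b b',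
  [/\ b' ∘ b = idm M, b ∘ b' = idm M' & b ∘ x = x' /\ y' ∘ b = y].
Proof. by move=> r /(real_class _ _ r)[b [[b' [? ?]] [? ?]]]; exists b, b'. Qed.

(** (ET4) for [i1] followed by [g] gives an inflation A1 >-> T whose cone is the middle term of a
    realization of [push p2 d], so it can be identified with [M2]. *)
Lemma pullback_half A1 A2 M2 C (S : ob B) (i1 : hom A1 S) (p1 : hom S A1)
    (p2 : hom S A2) (d1 : EE C A1) (d2 : EE C A2) (d : EE C S)
    (x2 : hom A2 M2) (y2 : hom M2 C) T (g : hom S T) (g' : hom T C) :
  p1 ∘ i1 = idm A1 -> realizes i1 p2 0 -> push p1 d = d1 -> push p2 d = d2 ->
  realizes x2 y2 d2 -> realizes g g' d ->
  exists u : hom A1 T, exists2 v : hom T M2, realizes u v (pull y2 d1) & y2 ∘ v = g'.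
Proof.
move=> p1i1 ri ed1 ed2 r2 rg.
have [E [e1 [e2 [h [d3 [[_ e2h] r3 rE _ ed3]]]]]] := et4 ri rg.
rewrite ed2 in rE; have [b [b' [b'b bb' [_ y2b]]]] := realizes_unique rE r2.
exists (g ∘ i1), (b ∘ h); last by rewrite compA y2b.
have -> : pull y2 d1 = pull b' d3.
  rewrite -[d3]push1 -p1i1 pushM ed3 push_pull ed1 -pullM; congr pull.
  by rewrite -y2b -compA bb' compf1.
exact: realizes_iso_right.
Qed.

(* The pullback is the middle term of a realization of the element of
   E(C, A1 + A2) with components [d1] and [d2]. *)
Lemma pullback_conf A1 A2 M1 M2 C (x1 : hom A1 M1) (y1 : hom M1 C) (d1 : EE C A1)
    (x2 : hom A2 M2) (y2 : hom M2 C) (d2 : EE C A2) :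
  realizes x1 y1 d1 -> realizes x2 y2 d2 ->
  exists T (u1 : hom A1 T) (v2 : hom T M2) (u2 : hom A2 T) (v1 : hom T M1),
  [/\ realizes u1 v2 (pull y2 d1), realizes u2 v1 (pull y1 d2) & y1 ∘ v1 = y2 ∘ v2].
Proof.
move=> r1 r2; pose d := push (bi1 A1 A2) d1 + push (bi2 A1 A2) d2.
have e1 : push (bp1 A1 A2) d = d1.
  by rewrite pushD -!pushM bp1i1 bp1i2 push1 push0 addr0.
have e2 : push (bp2 A1 A2) d = d2.
  by rewrite pushD -!pushM bp2i1 bp2i2 push1 push0 add0r.
have [T [g [g' rg]]] := real_ex d.
have [u1 [v2 ru1 yv2]] := pullback_half (bp1i1 _ _) (et2_split _ _) e1 e2 r2 rg.
have [u2 [v1 ru2 yv1]] := pullback_half (bp2i2 _ _) (split_swap _ _) e2 e1 r1 rg.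
by exists T, u1, v2, u2, v1; rewrite yv1 yv2.
Qed.

Lemma conflation_split_isom A M C (x : hom A M) (y : hom M C) :
  conflation x y -> (forall d : EE C A, d = 0) -> exists b : hom (bsum A C) M, isom b.
Proof. by case=> d r d0; apply: (@realizes_0_isom _ _ _ x y); rewrite -(d0 d). Qed.

(* A deflation [p] onto the target of [f] makes [(-f, p)] a deflation: it is
   [idm + p] followed by the projection along the graph of [f]. *)
Lemma deflation_pair X P K A (x : hom K P) (p : hom P A) (f : hom X A) :
  conflation x p -> exists L (l : hom L (bsum X P)),
    conflation l (p ∘ bp2 X P - f ∘ bp1 X P).
Proof.
case=> d rd; have rs := et2_sum (realizes_0id X) rd.
have rg : realizes (bi1 X A + bi2 X A ∘ f) (bp2 X A - f ∘ bp1 X A) 0.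
  pose n := bi2 X A ∘ f ∘ bp1 X A.
  have nn : n ∘ n = 0.
    by rewrite /n -compA (compA (bp1 X A)) (compA (bp1 X A)) bp1i2 !comp0f compf0.
  have b1 : (idm _ - n) ∘ (idm _ + n) = idm _.
    by rewrite compDr compf1 compBl comp1f nn subr0 subrK.
  have b2 : (idm _ + n) ∘ (idm _ - n) = idm _.
    by rewrite compBr compf1 compDl comp1f nn addr0 addrK.
  have := realizes_equiv b1 b2 (et2_split X A).
  rewrite compDl compBr comp1f compf1 /n -!compA bp1i1 compf1 !compA bp2i2 comp1f.
  by [].
have [E [a [b [h [d3 [_ r3 _ _ _]]]]]] := et4op rg rs.
exists E, h, d3; move: r3; congr (realizes _ _ _).
rewrite /msum compBl !compDr -!compA !(compA (bp2 X A)) !(compA (bp1 X A)).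
by rewrite bp1i1 bp1i2 bp2i1 bp2i2 !comp0f !comp1f compf0 add0r addr0.
Qed.

End Isomorphisms.

Lemma pushout_conf (B : extriangulated) (A M1 M2 C1 C2 : ob B)
    (x1 : hom A M1) (y1 : hom M1 C1) (d1 : ext (xext B) C1 A)
    (x2 : hom A M2) (y2 : hom M2 C2) (d2 : ext (xext B) C2 A) :
  realizes x1 y1 d1 -> realizes x2 y2 d2 ->
  exists T (u1 : hom T C1) (v2 : hom M2 T) (u2 : hom T C2) (v1 : hom M1 T),
  [/\ realizes v2 u1 (push x2 d1), realizes v1 u2 (push x1 d2) & v1 ∘ x1 = v2 ∘ x2].
Proof.
move=> r1 r2.
exact: (@pullback_conf B^op C1 C2 M1 M2 A y1 x1 d1 y2 x2 d2 r1 r2).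
Qed.

(** * Vanishing of higher extensions *)

Section Vanishing.
Variable B : extriangulated.
Local Notation EE := (ext (xext B)).
Implicit Types A C K L M N P I X Y Z : ob B.

Definition ext0 X Y := forall d : EE X Y, d = 0.

Lemma ext0_mid A M C N (x : hom A M) (y : hom M C) :
  conflation x y -> ext0 N A -> ext0 N C -> ext0 N M.
Proof.
case=> d rd NA NC e; have [e' ->] := push_exact rd (NC (push y e)).
by rewrite (NA e') pushr0.
Qed.

Lemma ext0_midl A M C X (x : hom A M) (y : hom M C) :
  conflation x y -> ext0 A X -> ext0 C X -> ext0 M X.
Proof.
case=> d rd AX CX e; have [e' ->] := pull_exact rd (AX (pull x e)).
by rewrite (CX e') pullr0.
Qed.

Lemma ext0_retract N X Y (s : hom X Y) (r : hom Y X) :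
  r ∘ s = idm X -> ext0 N Y -> ext0 N X.
Proof. by move=> rs NY d; rewrite -[d]push1 -rs pushM (NY (push s d)) pushr0. Qed.

(** Dimension shift in both variables at once: elements of E(K, L) and of E(N, Z) all come from
    morphisms K -> Z, by pulling back the class of Z and by pushing out the class of N. *)
Lemma ext0_syzygy K P N L I Z (k : hom K P) (p : hom P N) (i : hom L I) (z : hom I Z) :
  conflation k p -> projective P -> conflation i z -> injective_ob I ->
  ext0 N Z <-> ext0 K L.
Proof.
case=> e re Pp [d rd] Ii; split=> H u.
  have [t ->] := push0_pull rd (Ii _ (push i u)).
  have [g ->] := push0_extend re (H (push t e)).
  by rewrite pullM (Pp _ (pull g d)) pullr0.
have [t ->] := pull0_push re (Pp _ (pull p u)).
have [g ->] := pull0_lift rd (H (pull t d)).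
by rewrite pushM (Ii _ (push g e)) pushr0.
Qed.

Variables (hP : enough_projectives B) (Sig : nat -> ob B -> ob B).
Hypothesis hSig : cosyzygy_choice Sig.

(** This is the vanishing of E^{j+1}(N, X): the index is one below the degree. *)
Definition van j N X := ext0 N (Sig j X).

Lemma van0 N X : van 0 N X <-> ext0 N X.
Proof. by rewrite /van hSig.1. Qed.

Lemma van_syzygy j K P N X (k : hom K P) (p : hom P N) :
  conflation k p -> projective P -> van j.+1 N X <-> van j K X.
Proof.
move=> kp Pp; have [I [i [z [Ii iz]]]] := hSig.2 j X.
exact: (ext0_syzygy kp Pp iz Ii).
Qed.

Lemma van_left j A M C X (x : hom A M) (y : hom M C) :
  conflation x y -> van j A X -> van j.+1 M X -> van j.+1 C X.
Proof.
case=> d rd AX MX u; have [I [i [z [Ii [e re]]]]] := hSig.2 j X.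
have [t ->] := pull0_push rd (MX (pull y u)).
have [g ->] := pull0_lift re (AX (pull t e)).
by rewrite pushM (Ii _ (push g d)) pushr0.
Qed.

(** Replacing [N] by iterated syzygies, which stay in [Q], brings every degree down to the first. *)
Lemma van_ind (Q : ob B -> Prop) X j N :
  (forall K P N (k : hom K P) (p : hom P N), Q N -> conflation k p -> projective P -> Q K) ->
  (forall N, Q N -> ext0 N X) -> Q N -> van j N X.
Proof.
move=> QK Q0; elim: j N => [|j IH] N QN; first by apply/van0/Q0.
have [P [K [k [p [Pp kp]]]]] := hP N.
by apply/(van_syzygy _ _ kp Pp)/IH/(QK _ _ _ k p QN kp Pp).
Qed.

Lemma van_injective j N I : injective_ob I -> van j N I.
Proof. by move=> Ii; apply: (@van_ind (fun=> True)) => // C _; apply: Ii. Qed.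

(** The cosyzygies in [Sig] are arbitrary choices, not functorial in the object. Changes of the
    second variable are therefore handled by taking syzygies of [N] until only [ext0] remains. *)
Lemma van_retract j N X Y (s : hom X Y) (r : hom Y X) :
  r ∘ s = idm X -> van j N Y -> van j N X.
Proof.
move=> rs; elim: j N => [|j IH] N; first by move/van0/(ext0_retract rs)/van0.
have [P [K [k [p [Pp kp]]]]] := hP N.
by move/(van_syzygy _ _ kp Pp)/IH/(van_syzygy _ _ kp Pp).
Qed.

Lemma van_mid j N A M C (x : hom A M) (y : hom M C) :
  conflation x y -> van j N A -> van j N C -> van j N M.
Proof.
move=> xy; elim: j N => [|j IH] N.
  by move=> /van0 NA /van0 NC; apply/van0/(ext0_mid xy).
have [P [K [k [p [Pp kp]]]]] := hP N.
move=> /(van_syzygy _ _ kp Pp) KA /(van_syzygy _ _ kp Pp) KC.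
by apply/(van_syzygy _ _ kp Pp)/IH.
Qed.

Lemma van_right j N A M C (x : hom A M) (y : hom M C) :
  conflation x y -> van j.+1 N A -> van j N M -> van j N C.
Proof.
move=> xy; elim: j N => [|j IH] N; have [P [K [k [p [Pp kp]]]]] := hP N.
  move=> /(van_syzygy _ _ kp Pp)/van0 KA /van0 NM; apply/van0 => u.
  case: xy kp => d rd [e re].
  have [t ->] := pull0_push re (Pp _ (pull p u)).
  have [g ->] := pull0_lift rd (KA (pull t d)).
  by rewrite pushM (NM (push g e)) pushr0.
move=> /(van_syzygy _ _ kp Pp) KA /(van_syzygy _ _ kp Pp) KM.
by apply/(van_syzygy _ _ kp Pp)/IH.
Qed.

Lemma van_kernel j N A M C (x : hom A M) (y : hom M C) :
  conflation x y -> van j N C -> van j.+1 N M -> van j.+1 N A.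
Proof.
move=> xy; elim: j N => [|j IH] N; have [P [K [k [p [Pp kp]]]]] := hP N.
  move=> /van0 NC /(van_syzygy _ _ kp Pp)/van0 KM.
  apply/(van_syzygy _ _ kp Pp)/van0 => u.
  case: xy kp => d rd [e re].
  have [t ->] := push0_pull rd (KM (push x u)).
  have [g ->] := push0_extend re (NC (push t e)).
  by rewrite pullM (Pp _ (pull g d)) pullr0.
move=> /(van_syzygy _ _ kp Pp) KC /(van_syzygy _ _ kp Pp) KM.
by apply/(van_syzygy _ _ kp Pp)/IH.
Qed.

(** The bottom of the long exact sequence, where lifting morphisms replaces the vanishing of an
    extension group. *)
Lemma ext0_kernel N A M C (x : hom A M) (y : hom M C) :
  conflation x y -> (forall f : hom N C, exists g, f = y ∘ g) -> ext0 N M -> ext0 N A.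
Proof.
case=> d rd lift NM u; have [t ->] := push0_pull rd (NM (push x u)).
by have [g ->] := lift t; apply: (pull_lift rd).
Qed.

End Vanishing.

(** * The cotorsion pairs of a cluster tilting subcategory *)

Section ClusterTilting.
Variable B : extriangulated.
Local Notation EE := (ext (xext B)).
Implicit Types A C K L N P I X Y Z : ob B.
Variables (hP : enough_projectives B) (hI : enough_injectives B).
Variables (Sig : nat -> ob B -> ob B) (hSig : cosyzygy_choice Sig).
Variables (m : nat) (m_gt0 : (0 < m)%N) (M : ob B -> Prop).
Hypothesis hM : cluster_tilting Sig m.+1 M.
Local Notation van := (van Sig).
(** Here n = m + 1, and indices start at zero: [Mi i] is M_{i+1}. *)
Local Notation Mi i := (M_sub M i.+1).

Lemma ct_vanP X : M X <-> forall N j, M N -> (j < m)%N -> van j N X.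
Proof.
split=> [/(ct_right hM) H N j MN jm|H]; first by apply: (H N j.+1 MN); rewrite subn1.
apply/(ct_right hM) => N [|j] MN; rewrite subn1 //= => jm.
exact: H.
Qed.

Lemma ct_rigid X Y : M X -> M Y -> ext0 X Y.
Proof. by move=> MX /ct_vanP H; apply/(van0 hSig)/H. Qed.

Lemma ct_injective I : injective_ob I -> M I.
Proof. by move=> Ii; apply/ct_vanP => N j _ _; apply: van_injective. Qed.

Lemma ct_projective P : projective P -> M P.
Proof. by move=> Pp; apply/(ct_left hM) => N i _ _ d; apply: Pp. Qed.

(** Adding a deflation from a projective, which lies in [M], turns an [M]-approximation into a
    deflation. *)
Lemma ct_approx X : exists K M0 (k : hom K M0) (f : hom M0 X),
  [/\ M M0, conflation k f & forall N (g : hom N X), M N -> exists h, g = f ∘ h].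
Proof.
have [M0 [f [MM0 fP]]] := ct_contra hM X.
have [P [K [k [p [Pp kp]]]]] := hP X.
have [L [l lf]] := deflation_pair f kp.
exists L, (bsum M0 P), l, (p ∘ bp2 M0 P - f ∘ bp1 M0 P); split=> //.
  apply/ct_vanP => N j MN jm; have sMP : conflation (bi1 M0 P) (bp2 M0 P).
    by exists 0; apply: et2_split.
  by apply: (van_mid hP hSig sMP); apply: (iffLR (ct_vanP _)) => //; apply: ct_projective.
(* The minus sign cancels the one that [f] carries in the deflation. *)
move=> N g MN; have [h ->] := fP N g MN.
exists (- (bi1 M0 P ∘ h)); rewrite compNr compBl -!compA !(compA (bp1 _ _)) !(compA (bp2 _ _)).
by rewrite bp1i1 bp2i1 comp0f comp1f compf0 sub0r opprK.
Qed.

(** Taking a cone gives up the top degree of vanishing. Conversely the kernel of an approximation of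
    [X] regains it: degree one vanishes because maps from [M] lift, the others are shifted from [X].
    At [i = m] the condition is empty, so M_n is everything. *)
Lemma M_subP i X : (i <= m)%N ->
  Mi i X <-> forall N j, M N -> (j < m - i)%N -> van j N X.
Proof.
elim: i X => [|i IH] X im; first by rewrite subn0; apply: ct_vanP.
have {}IH := IH _ (ltnW im).
split.
  case=> K [M0 [x [y [MK MM0 xy]]]] N j MN; rewrite ltn_subRL => jm.
  apply: (van_right hP hSig xy).
    by apply: (iffLR (IH K)) => //; rewrite ltn_subRL addnS.
  apply: (iffLR (ct_vanP _)) => //; apply: leq_ltn_trans jm; exact: leq_addl.
move=> H; have [K [M0 [k [f [MM0 kf fP]]]]] := ct_approx X.
exists K, M0, k, f; split=> //; apply/IH => N [|j] MN jm.
  apply/(van0 hSig)/(ext0_kernel kf); last exact: ct_rigid.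
  by move=> g; apply: fP.
apply: (van_kernel hP hSig kf); first by apply: H => //; rewrite subnS; case: (m - i)%N jm.
apply: (iffLR (ct_vanP _)) => //; apply: leq_trans jm _; exact: leq_subr.
Qed.

Lemma M_sub_ext i A C X (x : hom A X) (y : hom X C) : (i <= m)%N ->
  conflation x y -> Mi i A -> Mi i C -> Mi i X.
Proof.
move=> im xy /(M_subP _ im) HA /(M_subP _ im) HC; apply/(M_subP _ im) => N j MN jm.
by apply: (van_mid hP hSig xy); [apply: HA | apply: HC].
Qed.

Lemma M_sub_le i k X : (i <= k <= m)%N -> Mi i X -> Mi k X.
Proof.
case/andP=> ik km /(M_subP _ (leq_trans ik km)) H; apply/(M_subP _ km) => N j MN jm.
by apply: H => //; apply: leq_trans jm _; apply: leq_sub2l.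
Qed.

(** Each cosyzygy enlarges the class tested against by one step and costs one degree. For the direct
    implication, a test object N is the cone of N1 >-> N0, and degrees are shifted in both
    variables. *)
Lemma Sigma_subP i k X : (i + k < m)%N ->
  Sigma_sub i (Mi k) X <->
  forall N j, Mi i N -> (j < m - k - i)%N -> van j N X.
Proof.
elim: i X => [|i IH] X ikm.
  rewrite subn0 /=; apply: M_subP; exact: ltnW.
have {}IH := IH _ (ltnW ikm).
have im : (i < m)%N by apply: leq_trans (ltnW ikm); apply: leq_addr.
split.
  case=> L [I [x [y [SL Ii xy]]]] N j [N1 [N0 [a [b [MN1 MN0 ab]]]]].
  rewrite ltn_subRL => jm.
  apply: (van_right hP hSig xy); last exact: van_injective.
  move/IH: SL => SL; have jm' : (j.+1 < m - k - i)%N by rewrite ltn_subRL addnS.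
  apply: (van_left hSig ab); first by apply: SL => //; apply: ltnW.
  by apply: SL => //; apply: (@M_sub_le 0); rewrite //= ltnW.
(* For an approximation M0 ->> X and an inflation M0 >-> I with cone C, ET4
   gives X >-> E ->> C, which splits since E(C,X) = 0; hence a deflation
   I ->> E ->> X through which the approximation factors. *)
move=> H; have mk : (0 < m - k - i.+1)%N by rewrite -subnDA subn_gt0 addnC.
have [K [M0 [k0 [f [MM0 kf fP]]]]] := ct_approx X.
have [I [C [a [b [Ii [d rd]]]]]] := hI M0.
case: kf => e re.
have MC : Mi i.+1 C.
  apply: (@M_sub_le 1); first by rewrite im.
  by exists M0, I, a, b; split=> //; [apply: ct_injective | exists d].
have [E [s [t [h [d3 [[hs _] r3 rE _ _]]]]]] := et4 re rd.
rewrite (iffLR (van0 hSig C X) (H C 0%N MC mk) (push f d)) in rE.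
have [r [c [rs rr]]] := split_retraction rE.
have [L [u [v [w [d4 [_ r4 _ _ _]]]]]] := et4op rr r3.
exists L, I, w, (r ∘ h); split=> //; last by exists d4.
(* Embed [N] in an injective [J]. The cone [D] lies in M_{i+2}, so E(D, X) = 0 and [g] extends to
   [J]; as [J] is in [M], the extension factors through the approximation. *)
have lift N : Mi i N -> forall g : hom N X, exists g', g = r ∘ h ∘ g'.
  move=> MN g; have [J [D [p [q [Ji [d5 r5]]]]]] := hI N.
  have MD : Mi i.+1 D by exists N, J, p, q; split=> //; [apply: ct_injective | exists d5].
  have [g1 ->] := push0_extend r5 (iffLR (van0 hSig D X) (H D 0%N MD mk) (push g d5)).
  have [g2 ->] := fP J g1 (ct_injective Ji).
  by exists (a ∘ g2 ∘ p); rewrite !compA -(compA r) hs compA rs comp1f.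
apply/IH => N [|j] MN jm.
  apply/(van0 hSig)/(ext0_kernel (ex_intro _ d4 r4)); first exact: lift.
  by apply/(van0 hSig)/(van_injective hP hSig).
apply: (van_kernel hP hSig (ex_intro _ d4 r4)); last exact: van_injective.
apply: H; first by apply: (M_sub_le _ MN); rewrite leqnSn.
by rewrite subnS; case: (m - k - i)%N jm.
Qed.

(* With V >-> U ->> K given by induction for the kernel K of a deflation
   M0 ->> A, push out along V >-> I with I injective: the pushout T is I + K,
   so T >-> Q ->> A with Q an extension of M0 by I, and the cone of the composite
   U >-> T >-> Q is the required approximation of A. *)
Lemma M_left_approx i k A : (i + k < m)%N -> Mi (i + k).+1 A ->
  exists (V U : ob B) (v : hom V U) (u : hom U A),
    [/\ Sigma_sub i (Mi k) V, Mi i U & conflation v u].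
Proof.
elim: i A => [|i IH] A ikm; first by [].
case=> K [M0 [x [y [MK MM0 [e re]]]]].
have [V [U [v [u [SV MU [d rd]]]]]] := IH K (ltnW ikm) MK.
have [I [C [a [b [Ii [e' re']]]]]] := hI V.
have [T [t1 [i1 [t2 [u1 [r1 r2 _]]]]]] := pushout_conf rd re'.
rewrite (Ii _ (push a d)) in r1; have [s st] := split_section r1.
have [Q [q [q' rq]]] := real_ex (push s e).
have [E [f [g [h [d3 [_ r3 rE _ _]]]]]] := et4 r1 rq.
rewrite -pushM st push1 in rE.
have [w [w' [ww w'w _]]] := realizes_unique re rE.
have ME : M E.
  apply/ct_vanP => N j MN jm; apply: (van_retract hP hSig w'w).
  exact: (iffLR (ct_vanP M0)).
have MQ : M Q.
  apply: (@M_sub_ext 0 _ _ _ _ _ _ (ex_intro _ d3 r3)) => //; exact: ct_injective.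
have [D [f' [g' [h' [d4 [_ r4 rD _ _]]]]]] := et4 r2 rq.
exists C, D, f', g'; split; last by exists (push t2 (push s e)).
  by exists V, I, a, b; split=> //; exists e'.
by exists U, Q, (q ∘ u1), h'; split=> //; exists d4.
Qed.

Lemma van_closed (S : ob B -> Prop) c (Q : ob B -> Prop) :
  (forall X, Q X <-> forall N j, S N -> (j < c)%N -> van j N X) ->
  [/\ additive_sub Q, iso_closed Q & summand_closed Q].
Proof.
move=> HQ; split.
- split=> [|X Y /HQ QX /HQ QY]; apply/HQ => N j SN jc.
    by apply: van_injective => // C d; rewrite -[d]push1 zobP push0.
  have sXY : conflation (bi1 X Y) (bp2 X Y) by exists 0; apply: et2_split.
  by apply: (van_mid hP hSig sXY); [apply: QX | apply: QY].
- move=> X Y f [g [gf fg]] /HQ QX; apply/HQ => N j SN jc.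
  by apply: (van_retract hP hSig fg); apply: QX.
- move=> X Y /HQ QXY; split; apply/HQ => N j SN jc.
    by apply: (van_retract hP hSig (bp1i1 X Y)); apply: QXY.
  by apply: (van_retract hP hSig (bp2i2 X Y)); apply: QXY.
Qed.

Lemma M_Y_cotorsion l : (1 <= l <= m)%N -> cotorsion_pair (M_sub M l) (Y_sub M m.+1 l).
Proof.
(* With l = i + 1 and n - l = k + 1, the pair is [Mi i] and [Sigma_sub i (Mi k)], where i + k + 1 =
   m. *)
case: l => // i /= im; have [k ek] : exists k, (m - i = k.+1)%N.
  by move: im; rewrite -subn_gt0; case: (m - i)%N => // k _; exists k.
have eik : (i + k).+1 = m by rewrite -addnS -ek subnKC // ltnW.
have ikm : (i + k < m)%N by rewrite eik.
rewrite /Y_sub subSS ek [i.+1.-1]/=.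
(* Only degree one survives in [Sigma_subP], so Y_l is exactly the right orthogonal of M_l for E. *)
have c1 : (m - k - i = 1)%N by rewrite -subnDA -eik (addnC k) subSnn.
have HM X := @M_subP i X (ltnW im).
have HY X := @Sigma_subP i k X ikm; rewrite c1 in HY.
have [addM isoM sumM] := van_closed HM.
have [addY isoY sumY] := van_closed HY.
(* Since (i + k) + 1 = m, the membership required of [A] is an empty condition. *)
have left A : exists (V U : ob B) (v : hom V U) (u : hom U A),
    [/\ Sigma_sub i (Mi k) V, Mi i U & conflation v u].
  apply: M_left_approx => //; rewrite eik; apply/M_subP => // N j _.
  by rewrite subnn.
split=> //.
  by move=> X Y d MX /HY H; apply: (iffLR (van0 hSig X Y)) d; apply: H.
(* Salce's trick: pull the left approximation of the cone of A >-> I back along I ->> C; the result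
   is an extension of [I] by [V]. *)
move=> A; have [I [C [a [b [Ii [d rd]]]]]] := hI A.
have [V [U [v [u [SV MU [e re]]]]]] := left C.
have [T [f [g [f' [g' [r1 r2 _]]]]]] := pullback_conf rd re.
exists T, U, f, g; split=> //; last by exists (pull u d).
apply/HY => N j MN j1; apply: (van_mid hP hSig (ex_intro _ _ r2)).
  by apply: (iffLR (HY V)).
exact: van_injective.
Qed.
End ClusterTilting.

(** * Reflections and coreflections *)

Section CotorsionOpposite.
Variables (B : extriangulated) (U V : ob B -> Prop).

Lemma cotorsion_op : cotorsion_pair U V -> @cotorsion_pair B^op V U.
Proof.
case=> addU addV isoU isoV sumU sumV e0 left right; split=> //.
- by move=> X Y f [g [gf fg]]; apply: (isoV _ _ g); exists f.
- by move=> X Y f [g [gf fg]]; apply: (isoU _ _ g); exists f.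
- by move=> X Y d VX UY; apply: e0.
- move=> A; have [X [Y [x [y [VX UY [d r]]]]]] := right A.
  by exists Y, X, y, x; split=> //; exists d.
- move=> A; have [X [Y [x [y [VX UY [d r]]]]]] := left A.
  by exists Y, X, y, x; split=> //; exists d.
Qed.

Lemma Bplus_op X : @Bplus B^op V U X <-> Bminus U V X.
Proof.
split=> [[Y [W [y [x [UY [VW UW] [d r]]]]]]|[W [Y [x [y [[UW VW] UY [d r]]]]]]].
  by exists W, Y, x, y; split=> //; exists d.
by exists Y, W, y, x; split=> //; exists d.
Qed.

Lemma factors_op (X Y : ob B) (f : hom X Y) :
  @factors B^op (W_of V U) Y X f <-> factors (W_of U V) f.
Proof. by split; case=> Z [h [g [[VZ UZ] e]]]; exists Z, g, h. Qed.

Lemma coreflection_op (V0 X A : ob B) (v : hom V0 X) (x : hom X A) :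
  @reflection_sequence B^op V U A X V0 x v <-> coreflection_sequence U V v x.
Proof.
split=> [[BX VV0 cf H]|[BX VV0 cf H]]; case: (cf) => d r; split=> //;
  by [exact/Bplus_op | exists d].
Qed.

End CotorsionOpposite.

Section Reflection.
Variables (B : extriangulated) (U V : ob B -> Prop).
Hypothesis cUV : cotorsion_pair U V.
Local Notation EE := (ext (xext B)).
Local Notation W := (W_of U V).
Implicit Types A C K L P I X Y Z : ob B.

(** The left approximation of [X] splits, making [X] a summand of an object of [U]. *)
Lemma cp_U_perp X : (forall Y, V Y -> ext0 X Y) -> U X.
Proof.
move=> X0; have [VX [UX [v [u [VVX UUX vu]]]]] := cp_left cUV X.
have [b [b' [b'b bb']]] := conflation_split_isom vu (X0 _ VVX).
have : U (bsum VX X) by apply: (cp_isoU cUV (f := b')) UUX; exists b.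
by case/(cp_summandU cUV).
Qed.

Lemma cp_U_ext A X C (x : hom A X) (y : hom X C) : conflation x y -> U A -> U C -> U X.
Proof.
move=> xy UA UC; apply: cp_U_perp => Y VY; apply: (ext0_midl xy).
  by move=> d; apply: (cp_ext0 cUV).
by move=> d; apply: (cp_ext0 cUV).
Qed.

Lemma W_additive : additive_sub W.
Proof.
have [U0 UD] := cp_addU cUV; have [V0 VD] := cp_addV cUV.
by split=> [|X Y [UX VX] [UY VY]]; split=> //; [apply: UD | apply: VD].
Qed.

(** Compose VA >-> UA with UA >-> W0 and take the cone [Z]. An element of E(A, V0) dies on UA, so it
    is pushed out from the class of UA ->> A, which extends to [Z] by (ET4). *)
Lemma reflection_ex A : exists Z U0 (z : hom A Z) (u : hom Z U0),
  reflection_sequence U V z u.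
Proof.
have [VA [UA [v [u [VVA UUA [d rd]]]]]] := cp_left cUV A.
have [W0 [U0 [w [t [VW0 UU0 wt]]]]] := cp_right cUV UA.
have UW0 := cp_U_ext wt UUA UU0; case: wt => e re.
have [Z [z [y [h [d3 [_ r3 rz zd3 _]]]]]] := et4 rd re.
exists Z, U0, z, y; split=> //; last 1 first.
- move=> V0 VV0 s; have [t0 ->] := pull0_push rd (cp_ext0 cUV (pull u s) UUA VV0).
  by exists (push t0 d3); rewrite -push_pull zd3.
- by exists VA, W0, (w ∘ v), h; split=> //; exists d3.
- by exists (push u e).
Qed.

(** The usable form of the surjectivity condition. Lift the class of VA >-> UA ->> A to [Z]; the
    dual of (ET4) then factors [d] through an object isomorphic to UA. *)
Lemma reflection_class A Z U0 (z : hom A Z) (u : hom Z U0) d :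
  reflection_sequence U V z u -> realizes z u d ->
  exists K (k : hom K A) (e : EE U0 K), U K /\ d = push k e.
Proof.
case=> _ _ _ surj rd; have [VA [UA [v [t [VVA UUA [c rc]]]]]] := cp_left cUV A.
have [c' zc'] := surj VA VVA c; have [T [a [b rT]]] := real_ex c'.
have [K [k [e [h [d3 [_ _ rk kd3 _]]]]]] := et4op rd rT; rewrite zc' in rk.
have [f [f' [f'f ff' _]]] := realizes_unique rk rc.
exists K, k, d3; split; last by rewrite kd3.
by apply: (cp_isoU cUV (f := f')) UUA; exists f.
Qed.

Lemma Bplus_factor K C (f : hom K C) : U K -> Bplus U V C -> factors W f.
Proof.
move=> UK [V0 [W0 [v [w [VV0 WW0 [d rd]]]]]].
have [g ->] := pull0_lift rd (cp_ext0 cUV (pull f d) UK VV0).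
by exists W0, w, g.
Qed.

(** The obstruction [push f d] comes from a morphism K -> C with K in [U]; this passes through [W],
    where E(U0, W) = 0. *)
Lemma reflection_factor A Z U0 (z : hom A Z) (u : hom Z U0) C (f : hom A C) :
  reflection_sequence U V z u -> Bplus U V C -> exists g, f = g ∘ z.
Proof.
move=> rzu BC; have [_ UU0 [d rd] _] := rzu.
have [K [k [e [UK ed]]]] := reflection_class rzu rd.
have [W0 [h [g [[_ VW0] efk]]]] := Bplus_factor (f ∘ k) UK BC.
apply: (push0_extend rd).
by rewrite ed -pushM efk pushM (cp_ext0 cUV (push g e)) // pushr0.
Qed.

(** The map A -> W0 extends to [Z] because E(U0, W0) = 0. What is left of [g] kills [z], so it
    factors through U0 -> C and hence through [W]. *)
Lemma reflection_unique A Z U0 (z : hom A Z) (u : hom Z U0) C (g : hom Z C) :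
  reflection_sequence U V z u -> Bplus U V C ->
  factors W (g ∘ z) -> factors W g.
Proof.
move=> [_ UU0 [d rd] _] BC [W0 [h [k [WW0 e]]]].
have [k' ek] := push0_extend rd (cp_ext0 cUV (push k d) UU0 WW0.2).
have [t et] : exists t, g - h ∘ k' = t ∘ u.
  by apply: (conf_cokernel rd); rewrite compBl e ek compA subrr.
apply/(in_idealP _ W_additive).
have -> : g = t ∘ u - - (h ∘ k') by rewrite -et opprK subrK.
apply: in_idealB.
  have [W1 [a [b [WW1 ->]]]] := Bplus_factor t UU0 BC.
  by apply: in_ideal_factors; exists W1, a, (b ∘ u); rewrite compA.
rewrite -[- _]sub0r; apply: in_idealB; first exact: in_ideal0.
by apply: in_ideal_factors; exists W0, h, k'.
Qed.

End Reflection.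

Section Coreflection.
Variables (B : extriangulated) (U V : ob B -> Prop).
Hypothesis cUV : cotorsion_pair U V.
Let cVU := cotorsion_op cUV.
Local Notation EE := (ext (xext B)).
Local Notation W := (W_of U V).
Implicit Types A C K L P I X Y Z : ob B.

Lemma cp_V_ext A X C (x : hom A X) (y : hom X C) : conflation x y -> V A -> V C -> V X.
Proof.
case=> d r VA VC.
have cf : @conflation B^op C X A y x by exists d.
refine (@cp_U_ext (B^op) V U cVU _ _ _ _ _ cf VC VA).
Qed.

Lemma coreflection_ex A : exists V0 X (v : hom V0 X) (x : hom X A),
  coreflection_sequence U V v x.
Proof.
have [X [V0 [x [v r]]]] := reflection_ex cVU A.
by exists V0, X, v, x; apply/coreflection_op.
Qed.

Lemma coreflection_factor V0 X A (v : hom V0 X) (x : hom X A) C (f : hom C A) :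
  coreflection_sequence U V v x -> Bminus U V C -> exists g, f = x ∘ g.
Proof.
by move=> /coreflection_op r /Bplus_op BC; have [g] := reflection_factor cVU f r BC; exists g.
Qed.

Lemma coreflection_unique V0 X A (v : hom V0 X) (x : hom X A) C (g : hom C X) :
  coreflection_sequence U V v x -> Bminus U V C -> factors W (x ∘ g) -> factors W g.
Proof.
move=> /coreflection_op r /Bplus_op BC /factors_op xg.
exact/factors_op/(reflection_unique cVU r BC).
Qed.

(** The pullback [T] of V1 and UX over X is in [V], as an extension of V1 by VX. It also splits as
    V0 + UX, so UX lies in [W]. *)
Lemma Cone_VV X : Cone V V X -> Bplus U V X.
Proof.
case=> V0 [V1 [x [y [VV0 VV1 [d rd]]]]].
have [VX [UX [v [u [VVX UUX [e re]]]]]] := cp_left cUV X.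
have [T [u1 [v2 [u2 [v1 [r1 r2 _]]]]]] := pullback_conf rd re.
have VT := cp_V_ext (ex_intro _ _ r2 : conflation u2 v1) VVX VV1.
rewrite (cp_ext0 cUV (pull u d) UUX VV0) in r1.
have [b [b' [b'b bb']]] := realizes_0_isom r1.
have : V (bsum V0 UX) by apply: (cp_isoV cUV (f := b')) VT; exists b.
case/(cp_summandV cUV) => _ VUX; exists VX, UX, v, u; split=> //.
by exists e.
Qed.

(** This puts the values of sigma^- after sigma^+ in the heart. The pullback of W1 ->> A along [x]
    lies in [V] and exhibits [X] as a cone of objects of [V]. *)
Lemma coreflection_Bplus V0 X A (v : hom V0 X) (x : hom X A) :
  coreflection_sequence U V v x -> Bplus U V A -> Bplus U V X.
Proof.
case=> _ VV0 [d rd] _ [V1 [W1 [a [b [VV1 [_ VW1] [e re]]]]]].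
have [T [u1 [v2 [u2 [v1 [r1 r2 _]]]]]] := pullback_conf re rd.
apply: Cone_VV; exists V1, T, u1, v2; split=> //; last by exists (pull x e).
exact: cp_V_ext (ex_intro _ _ r2 : conflation u2 v1) VV0 VW1.
Qed.

Lemma reflection_id A : Bplus U V A -> reflection_sequence U V (idm A) (0 : hom A zob).
Proof.
move=> BA; split=> //; first by have [] := cp_addU cUV.
  by exists 0; apply: realizes_id0.
by move=> V0 _ d; exists d; rewrite pull1.
Qed.

Lemma coreflection_id A : Bminus U V A -> coreflection_sequence U V (0 : hom zob A) (idm A).
Proof.
move=> BA; split=> //; first by have [] := cp_addV cUV.
  by exists 0; apply: realizes_0id.
by move=> U0 _ d; exists d; rewrite push1.
Qed.

End Coreflection.

Lemma dep_choice (T : Type) (F : T -> Type) (P : forall t, F t -> Prop) :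
  (forall t, exists y, P t y) -> exists f, forall t, P t (f t).
Proof. by move=> h; exists (fun t => sval (boolp.cid (h t))) => t; apply: svalP. Qed.

(** * The functors sigma and the heart functor *)

Section ReflectorFunctor.
Variables (S : preadditive) (P : ob S -> Prop) (R : ob S -> ob S).
Hypothesis PR : forall A, P (R A).

Section Left.
Variable p : forall A, hom A (R A).
Hypothesis univ : forall A C (f : hom A C), exists! g, g ∘ p A = p C ∘ f.

Definition reflector_map A C (f : hom A C) : hom (R A) (R C) := sval (boolp.cid (univ f)).

Lemma reflector_mapP A C (f : hom A C) :
  unique (fun g => g ∘ p A = p C ∘ f) (reflector_map f).
Proof. exact: (svalP (boolp.cid (univ f))). Qed.

Lemma reflector_map1 A : reflector_map (idm A) = idm (R A).
Proof. by apply: (reflector_mapP (idm A)).2; rewrite comp1f compf1. Qed.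

Lemma reflector_mapM A C D (g : hom C D) (f : hom A C) :
  reflector_map (g ∘ f) = reflector_map g ∘ reflector_map f.
Proof.
apply: (reflector_mapP (g ∘ f)).2.
by rewrite -compA (reflector_mapP f).1 !compA (reflector_mapP g).1.
Qed.

Definition reflector : functor S (fullsub P) :=
  @Functor S (fullsub P) (fun A => exist P (R A) (PR A)) (fun _ _ f => reflector_map f)
    reflector_map1 (fun _ _ _ g f => reflector_mapM g f).
End Left.

Section Right.
Variable m : forall A, hom (R A) A.
Hypothesis univ : forall A C (f : hom A C), exists! g, m C ∘ g = f ∘ m A.

Definition coreflector_map A C (f : hom A C) : hom (R A) (R C) := sval (boolp.cid (univ f)).

Lemma coreflector_mapP A C (f : hom A C) :
  unique (fun g => m C ∘ g = f ∘ m A) (coreflector_map f).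
Proof. exact: (svalP (boolp.cid (univ f))). Qed.

Lemma coreflector_map1 A : coreflector_map (idm A) = idm (R A).
Proof. by apply: (coreflector_mapP (idm A)).2; rewrite comp1f compf1. Qed.

Lemma coreflector_mapM A C D (g : hom C D) (f : hom A C) :
  coreflector_map (g ∘ f) = coreflector_map g ∘ coreflector_map f.
Proof.
apply: (coreflector_mapP (g ∘ f)).2.
by rewrite compA (coreflector_mapP g).1 -!compA (coreflector_mapP f).1.
Qed.

Definition coreflector : functor S (fullsub P) :=
  @Functor S (fullsub P) (fun A => exist P (R A) (PR A)) (fun _ _ f => coreflector_map f)
    coreflector_map1 (fun _ _ _ g f => coreflector_mapM g f).
End Right.
End ReflectorFunctor.

Section HeartFunctor.
Variables (B : extriangulated) (U V : ob B -> Prop).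
Hypothesis cUV : cotorsion_pair U V.
Local Notation W := (W_of U V).

Lemma qpi_eqW (X Y : ob B) (f g : hom X Y) : (qpi W f = qpi W g) <-> factors W (f - g).
Proof. exact: iff_trans (qpi_eq _ _ _) (in_idealP _ (W_additive cUV)). Qed.

Lemma sigma_plus_ex : exists (S : functor (stable U V) (stable_plus U V)) p,
  @sigma_plus_spec B U V S p.
Proof.
(* Object and map are chosen together as one dependent pair, so that the normalization on B^+ is the
   single equation of [sp_id]. *)
pose good (A : ob B) (Zz : {Z : ob B & @hom B A Z : Type}) :=
  (exists U0 (u : hom (projT1 Zz) U0), reflection_sequence U V (projT2 Zz) u) /\
  (Bplus U V A -> Zz = existT _ A (idm A)).
have [r rP] : exists r : forall A, {Z : ob B & @hom B A Z : Type}, forall A, good A (r A).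
  apply: (@dep_choice _ _ good) => A; have [BA|nBA] := pselect (Bplus U V A).
    by exists (existT _ A (idm A)); split=> //; exists zob, 0; apply: reflection_id.
  have [Z [U0 [z [u zu]]]] := reflection_ex cUV A.
  by exists (existT _ Z z); split=> //; exists U0, u.
pose R A := projT1 (r A); pose p A : @hom B A (R A) := projT2 (r A).
have rs A : exists U0 (u : hom (R A) U0), reflection_sequence U V (p A) u := (rP A).1.
have BR A : Bplus U V (R A) by have [U0 [u []]] := rs A.
pose q A : @hom (stable U V) A (R A) := qpi W (p A).
have univ (A C : ob (stable U V)) (f : hom A C) : exists! g, g ∘ q A = q C ∘ f.
  have [U0 [u zu]] := rs A.
  have [g eg] := reflection_factor cUV (p C ∘ repr f) zu (BR C).
  have eg' : (qpi W g : @hom (stable U V) (R A) (R C)) ∘ q A = q C ∘ f.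
    by rewrite /= -{1}(qpi_repr f) /q -!qpi_comp -eg.
  exists (qpi W g); split=> // g' e'; rewrite -[RHS]qpi_repr; apply/qpi_eqW.
  apply: (reflection_unique cUV zu (BR C)); rewrite compBl; apply/qpi_eqW.
  by rewrite !qpi_comp qpi_repr; exact: (etrans eg' (esym e')).
exists (@reflector (stable U V) _ R BR q univ), p; split.
- exact: rs.
- by move=> A BA; apply: etrans ((rP A).2 BA); apply: esym (sigT_eta _).
- by move=> A C f; apply: (@reflector_mapP (stable U V) R q univ A C f).
Qed.

Lemma sigma_minus_ex : exists (S : functor (stable U V) (stable_minus U V)) m,
  @sigma_minus_spec B U V S m.
Proof.
pose good (A : ob B) (Xx : {X : ob B & @hom B X A : Type}) :=
  (exists V0 (v : hom V0 (projT1 Xx)), coreflection_sequence U V v (projT2 Xx)) /\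
  (Bminus U V A -> Xx = existT _ A (idm A)).
have [r rP] : exists r : forall A, {X : ob B & @hom B X A : Type}, forall A, good A (r A).
  apply: (@dep_choice _ _ good) => A; have [BA|nBA] := pselect (Bminus U V A).
    by exists (existT _ A (idm A)); split=> //; exists zob, 0; apply: coreflection_id.
  have [V0 [X [v [x vx]]]] := coreflection_ex cUV A.
  by exists (existT _ X x); split=> //; exists V0, v.
pose R A := projT1 (r A); pose m A : @hom B (R A) A := projT2 (r A).
have rs A : exists V0 (v : hom V0 (R A)), coreflection_sequence U V v (m A) := (rP A).1.
have BR A : Bminus U V (R A) by have [V0 [v []]] := rs A.
pose q A : @hom (stable U V) (R A) A := qpi W (m A).
have univ (A C : ob (stable U V)) (f : hom A C) : exists! g, q C ∘ g = f ∘ q A.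
  have [V0 [v vx]] := rs C.
  have [g eg] := coreflection_factor cUV (repr f ∘ m A) vx (BR A).
  have eg' : q C ∘ (qpi W g : @hom (stable U V) (R A) (R C)) = f ∘ q A.
    by rewrite /= -{1}(qpi_repr f) /q -!qpi_comp -eg.
  exists (qpi W g); split=> // g' e'; rewrite -[RHS]qpi_repr; apply/qpi_eqW.
  apply: (coreflection_unique cUV vx (BR A)); rewrite compBr; apply/qpi_eqW.
  by rewrite !qpi_comp qpi_repr; exact: (etrans eg' (esym e')).
exists (@coreflector (stable U V) _ R BR q univ), m; split.
- exact: rs.
- by move=> A BA; apply: etrans ((rP A).2 BA); apply: esym (sigT_eta _).
- by move=> A C f; apply: (@coreflector_mapP (stable U V) R q univ A C f).
Qed.

Lemma heart_functor_ex : exists H, @heart_functor B U V H.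
Proof.
have [Sp [p sp]] := sigma_plus_ex; have [Sm [m sm]] := sigma_minus_ex.
have hH X : heart_ob U V (sval (Sm (sval (Sp X)))).
  split; last exact: (svalP (Sm _)).
  have [V0 [v vx]] := sm_seq sm (sval (Sp X)).
  by apply: (coreflection_Bplus cUV vx); apply: (svalP (Sp X)).
pose G := fcomp (@fullsub_incl (stable U V) (Bminus U V))
  (fcomp Sm (fcomp (@fullsub_incl (stable U V) (Bplus U V)) (fcomp Sp (quotient_fun W)))).
exists (@Functor B (heart U V) (fun X => exist (heart_ob U V) (G X) (hH X))
  (fun _ _ f => fun_map G f) (fun X => fun_map1 G X) (fun _ _ _ g f => fun_mapM G g f)).
exists Sp, p, Sm, m; split=> //.
by congr Functor; apply: Prop_irrelevance.
Qed.
End HeartFunctor.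

(** * Equivalences of categories *)

Section NatIso.
Variables C D E : category.

Lemma nat_iso_sym (F G : functor C D) : nat_iso F G -> nat_iso G F.
Proof.
case=> eta [ieta nat].
have [inv invP] := @dep_choice _ _
  (fun X g => ccomp g (eta X) = cid (F X) /\ ccomp (eta X) g = cid (G X)) ieta.
exists inv; split=> [X|X Y f]; first by exists (eta X); have [] := invP X.
rewrite -[RHS]ccomp1f -(invP Y).1 -ccompA (ccompA (eta Y)) nat -ccompA (ccompA _ _ (inv X)).
by rewrite -!ccompA (invP X).2 ccompf1.
Qed.

Lemma cat_iso_comp (X Y Z : cob C) (g : chom Y Z) (f : chom X Y) :
  cat_iso g -> cat_iso f -> cat_iso (ccomp g f).
Proof.
case=> g' [g'g gg'] [f' [f'f ff']]; exists (ccomp f' g'); split.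
  by rewrite -ccompA (ccompA g') g'g ccomp1f.
by rewrite -ccompA (ccompA f) ff' ccomp1f.
Qed.

Lemma nat_iso_whiskerl (G : functor D E) (F F' : functor C D) :
  nat_iso F F' -> nat_iso (fcomp G F) (fcomp G F').
Proof.
case=> eta [ieta nat]; exists (fun X => fun_map G (eta X)); split=> [X|X Y f].
  by have [g [gf fg]] := ieta X; exists (fun_map G g); rewrite /= -!fun_mapM gf fg !fun_map1.
by rewrite /= -!fun_mapM nat.
Qed.

Lemma nat_iso_whiskerr (G G' : functor D E) (F : functor C D) :
  nat_iso G G' -> nat_iso (fcomp G F) (fcomp G' F).
Proof.
case=> eta [ieta nat]; exists (fun X => eta (F X)); split=> [X|X Y f]; first exact: ieta.
exact: nat.
Qed.
End NatIso.

Lemma nat_iso_trans (C D : category) (F G H : functor C D) :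
  nat_iso F G -> nat_iso G H -> nat_iso F H.
Proof.
case=> eta [ieta nat] [eta' [ieta' nat']]; exists (fun X => ccomp (eta' X) (eta X)).
split=> [X|X Y f]; first exact: cat_iso_comp.
by rewrite -ccompA nat ccompA nat' -ccompA.
Qed.

Lemma equivalence_comp (C D E : category) (F : functor C D) (G : functor D E) :
  is_equivalence F -> is_equivalence G -> is_equivalence (fcomp G F).
Proof.
case=> F' [F'F FF'] [G' [G'G GG']]; exists (fcomp F' G'); split.
  have := nat_iso_whiskerl F' (nat_iso_whiskerr F G'G).
  by move/nat_iso_trans; apply; exact: F'F.
have := nat_iso_whiskerl G (nat_iso_whiskerr G' FF').
by move/nat_iso_trans; apply; exact: GG'.
Qed.

Section FullyFaithful.
Variables (C D : category) (F : functor C D).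
Hypothesis faithful : forall X Y (f g : chom X Y), fun_map F f = fun_map F g -> f = g.
Hypothesis full : forall X Y (h : chom (F X) (F Y)), exists f : chom X Y, fun_map F f = h.
Hypothesis dense : forall Z, exists X (f : chom (F X) Z), cat_iso f.

Lemma ff_dense_equivalence : is_equivalence F.
Proof.
have [G0 G0P] := @dep_choice _ _ (fun Z X => exists f : chom (F X) Z, cat_iso f) dense.
have [e eP] := @dep_choice _ _ (fun Z (f : chom (F (G0 Z)) Z) => cat_iso f) G0P.
have [e' e'P] := @dep_choice _ _ (fun Z g => ccomp g (e Z) = cid _ /\ ccomp (e Z) g = cid Z) eP.
have [lift liftP] := @dep_choice {XY : cob C * cob C & chom (F XY.1) (F XY.2)} _
  (fun t (f : chom (projT1 t).1 (projT1 t).2) => fun_map F f = projT2 t)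
  (fun t => full (projT2 t)).
pose L X Y (h : chom (F X) (F Y)) : chom X Y :=
  lift (existT (fun XY : cob C * cob C => chom (F XY.1) (F XY.2)) (X, Y) h).
have FL X Y (h : chom (F X) (F Y)) : fun_map F (L X Y h) = h.
  exact: (liftP (existT (fun XY : cob C * cob C => chom (F XY.1) (F XY.2)) (X, Y) h)).
pose Gm Y Z (g : chom Y Z) : chom (G0 Y) (G0 Z) := L _ _ (ccomp (e' Z) (ccomp g (e Y))).
have Gm1 Z : Gm Z Z (cid Z) = cid (G0 Z).
  by apply: faithful; rewrite FL fun_map1 ccomp1f (e'P Z).1.
have GmM X Y Z (g : chom Y Z) (f : chom X Y) : Gm _ _ (ccomp g f) = ccomp (Gm _ _ g) (Gm _ _ f).
  apply: faithful; rewrite fun_mapM !FL -!ccompA; congr ccomp; congr ccomp.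
  by rewrite ccompA (e'P Y).2 ccomp1f.
exists (@Functor D C G0 Gm Gm1 GmM); split.
  exists (fun X => L _ _ (e (F X))); split=> [X|X Y f].
    exists (L _ _ (e' (F X))); split; apply: faithful; rewrite fun_mapM !FL fun_map1.
      exact: (e'P _).1.
    exact: (e'P _).2.
  apply: faithful; rewrite !fun_mapM !FL /= ccompA (e'P _).2.
  by rewrite ccomp1f.
exists e; split=> // X Y f /=; rewrite FL ccompA (e'P Y).2.
by rewrite ccomp1f.
Qed.
End FullyFaithful.

(** * Coherent functors *)

Section Presentation.
Variable A : preadditive.
Implicit Types F G : abfun A.

(** Through the Yoneda lemma this is exactness of A(-,A1) -> A(-,A0) -> F -> 0, with the second map
    given by the element [s]. *)
Definition presents F (A1 A0 : ob A) (f : hom A1 A0) (s : F A0) : Prop :=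
  (forall X (u : F X), exists t, af_map F t s = u) /\
  (forall X (t : hom X A0), af_map F t s = 0 <-> exists r, f ∘ r = t).

Lemma af_mapB F (X Y : ob A) (f g : hom X Y) (s : F Y) :
  af_map F (f - g) s = af_map F f s - af_map F g s.
Proof. by apply: (addIr (af_map F g s)); rewrite -af_add !subrK. Qed.

Definition yoneda_elem F A0 (s : F A0) : abtrans (yoneda A0) F :=
  @Abtrans A (yoneda A0) F (fun X t => af_map F t s)
    (fun X t t' => af_add t t' s) (fun X Y f t => af_mapM t f s).

Lemma coherentP F :
  coherent F <-> exists A1 A0 (f : hom A1 A0) (s : F A0), presents f s.
Proof.
split=> [[A1 [A0 [a [p ap]]]]|[A1 [A0 [f [s [gen rel]]]]]]; last first.
  exists A1, A0, (@yoneda_elem (yoneda A0) A1 f), (yoneda_elem s) => X.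
  by split; [apply: gen | apply: rel].
have pE X (t : hom X A0) : p X t = af_map F t (p A0 (idm A0)).
  by rewrite -at_nat /= comp1f.
have aE X (r : hom X A1) : a X r = a A1 (idm A1) ∘ r.
  by rewrite -[RHS]/(af_map (yoneda A0) r (a A1 (idm A1))) -at_nat /= comp1f.
exists A1, A0, (a A1 (idm A1)), (p A0 (idm A0)); split=> X.
  by move=> u; have [t <-] := (ap X).1 u; exists t.
move=> t; rewrite -pE; apply: iff_trans ((ap X).2 t) _.
by split; case=> r <-; exists r; [apply: esym (aE X r) | apply: aE].
Qed.

(** Send [u] to the value at [s'] of any chosen [t] producing it; [rel] makes this independent of
    the choice, hence additive and natural. *)
Lemma generated_map F G A0 (s : F A0) (s' : G A0) :
  (forall X (u : F X), exists t, af_map F t s = u) ->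
  (forall X (t : hom X A0), af_map F t s = 0 -> af_map G t s' = 0) ->
  exists u : abtrans F G, forall X (t : hom X A0), u X (af_map F t s) = af_map G t s'.
Proof.
move=> gen rel.
have [c cP] := @dep_choice {X : ob A & F X} (fun z => hom (projT1 z) A0)
  (fun z t => af_map F t s = projT2 z) (fun z => gen _ (projT2 z)).
pose phi X (u : F X) : G X := af_map G (c (existT (fun X => F X : Type) X u)) s'.
have phiE X (t : hom X A0) : phi X (af_map F t s) = af_map G t s'.
  apply/eqP; rewrite -subr_eq0 -af_mapB; apply/eqP/rel.
  by rewrite af_mapB (cP (existT _ X _)) subrr.
have phiD X u v : phi X (u + v) = phi X u + phi X v.
  by have [t <-] := gen X u; have [t' <-] := gen X v; rewrite -af_add !phiE af_add.
have phiN X Y (f : hom X Y) u : phi X (af_map F f u) = af_map G f (phi Y u).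
  by have [t <-] := gen Y u; rewrite -af_mapM !phiE af_mapM.
by exists (@Abtrans A F G phi phiD phiN).
Qed.

Lemma presents_iso (F G : cob (mod_cat A)) A1 A0 (f : hom A1 A0)
    (s : sval F A0) (s' : sval G A0) :
  presents f s -> presents f s' -> exists u : chom F G, cat_iso u.
Proof.
move=> [gen rel] [gen' rel'].
have [u uE] := generated_map (G := sval G) (s' := s') gen
  (fun X t h => iffRL (rel' X t) (iffLR (rel X t) h)).
have [v vE] := generated_map (G := sval F) (s' := s) gen'
  (fun X t h => iffRL (rel X t) (iffLR (rel' X t) h)).
exists u, v; split; apply: abtrans_eq => X x /=.
  by have [t <-] := gen X x; rewrite uE vE.
by have [t <-] := gen' X x; rewrite vE uE.
Qed.

Lemma bijective_mod_iso (F G : cob (mod_cat A)) (u : chom F G) :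
  (forall X (x : sval F X), u X x = 0 -> x = 0) ->
  (forall X (y : sval G X), exists x, u X x = y) -> cat_iso u.
Proof.
move=> inj surj; have [c cP] := @dep_choice {X : ob A & sval G X} (fun z => sval F (projT1 z))
  (fun z x => u _ x = projT2 z) (fun z => surj _ (projT2 z)).
pose v X (y : sval G X) : sval F X := c (existT (fun X => sval G X : Type) X y).
have uv X y : u X (v X y) = y by apply: (cP (existT _ X y)).
have u0 X : u X 0 = 0 by apply: (addrI (u X 0)); rewrite -at_compD !addr0.
have uN X x : u X (- x) = - u X x by apply: (addrI (u X x)); rewrite -at_compD !subrr u0.
have {}inj X x x' : u X x = u X x' -> x = x'.
  move=> e; apply/eqP; rewrite -subr_eq0; apply/eqP/inj.
  by rewrite at_compD uN e subrr.
have vD X y y' : v X (y + y') = v X y + v X y' by apply: inj; rewrite at_compD !uv.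
have vN X Y (f : hom X Y) y : v X (af_map (sval G) f y) = af_map (sval F) f (v Y y).
  by apply: inj; rewrite at_nat !uv.
exists (@Abtrans A (sval G) (sval F) v vD vN); split; apply: abtrans_eq => X x /=.
  by apply: inj; rewrite uv.
exact: uv.
Qed.

End Presentation.

(** * Extensions restricted to the cluster tilting subcategory *)

Section ExtFunctor.
Variables (B : extriangulated) (M : ob B -> Prop).
Local Notation EE := (ext (xext B)).
Local Notation A := (subquotient M (@projective B)).
Implicit Types K L P X Y Z : ob B.

(** This lets E(-, X) descend to M/P, where it acts through representatives. *)
Lemma pull_ideal (N N' X : ob B) (f : hom N N') (e : EE N' X) :
  in_ideal (@projective B) f -> pull f e = 0.
Proof.
elim=> [|{}f [P [h [g [Pp ->]]]]|f1 f2 _ e1 _ e2]; first exact: pull0.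
  by rewrite pullM (Pp _ (pull h e)) pullr0.
by rewrite pull_sub e1 e2 subrr.
Qed.

Lemma pull_qpi (N N' X : ob B) (f g : hom N N') (e : EE N' X) :
  qpi (@projective B) f = qpi (@projective B) g -> pull f e = pull g e.
Proof.
by move=> /qpi_eq /(pull_ideal e) fg; apply/eqP; rewrite -subr_eq0 -pull_sub fg.
Qed.

Lemma pull_repr (N N' X : ob B) (f : hom N N') (e : EE N' X) :
  pull (repr (qpi (@projective B) f)) e = pull f e.
Proof. by apply: pull_qpi; rewrite qpi_repr. Qed.

Definition ext_map X (N N' : ob A) (f : hom N N') (e : EE (sval N') X) : EE (sval N) X :=
  pull (repr f : @hom B (sval N) (sval N')) e.

Lemma ext_mapD X (N N' : ob A) (f : hom N N') (s t : EE (sval N') X) :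
  ext_map f (s + t) = ext_map f s + ext_map f t.
Proof. exact: pullD. Qed.

Lemma ext_map1 X (N : ob A) (s : EE (sval N) X) : ext_map (idm N) s = s.
Proof. by rewrite /ext_map pull_repr pull1. Qed.

Lemma ext_mapM X (N N' N'' : ob A) (g : hom N' N'') (f : hom N N') (s : EE (sval N'') X) :
  ext_map (g ∘ f) s = ext_map f (ext_map g s).
Proof. by rewrite /ext_map pull_repr pullM. Qed.

Lemma ext_map_add X (N N' : ob A) (f g : hom N N') (s : EE (sval N') X) :
  ext_map (f + g) s = ext_map f s + ext_map g s.
Proof.
rewrite /ext_map -pull_add; apply: pull_qpi.
by rewrite qpiD !qpi_repr.
Qed.

Definition ext_fun X : abfun A :=
  @Abfun A (fun N => EE (sval N) X) (fun _ _ f => ext_map f)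
    (fun _ _ f => ext_mapD f) (@ext_map1 X) (fun _ _ _ g f => ext_mapM g f)
    (fun _ _ f g => ext_map_add f g).

Lemma ext_trans_nat X Y (f : hom X Y) (N N' : ob A) (g : hom N N') (s : ext_fun X N') :
  push f (af_map (ext_fun X) g s) = af_map (ext_fun Y) g (push f s).
Proof. exact: push_pull. Qed.

Definition ext_trans X Y (f : hom X Y) : abtrans (ext_fun X) (ext_fun Y) :=
  @Abtrans A (ext_fun X) (ext_fun Y) (fun N e => push f e)
    (fun N => @pushD _ _ _ _ _ f) (fun _ _ g s => ext_trans_nat f g s).

Lemma ext_presents X (M1 M0 : ob B) (MM1 : M M1) (MM0 : M M0) (f : hom M1 M0) (d : EE M0 X) :
  (forall N (u : EE N X), M N -> exists t, pull t d = u) ->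
  (forall N (t : hom N M0), M N -> pull t d = 0 ->
     exists r, qpi (@projective B) (f ∘ r) = qpi (@projective B) t) ->
  pull f d = 0 ->
  @presents A (ext_fun X) (exist _ M1 MM1) (exist _ M0 MM0) (qpi (@projective B) f) d.
Proof.
move=> gen rel fd; split=> [[N MN] /= u|[N MN] /= t].
  have [t <-] := gen N u MN; exists (qpi (@projective B) t).
  exact: pull_repr.
split.
  rewrite -[t]qpi_repr /ext_map pull_repr => /(rel N _ MN)[r e].
  by exists (qpi (@projective B) r); rewrite -e qpi_comp.
case=> r <-; rewrite /ext_map -[r]qpi_repr -qpi_comp pull_repr pullM fd.
exact: pullr0.
Qed.

Hypothesis (hI : enough_injectives B).
Hypothesis Mcf : contravariantly_finite M.
Hypothesis Mrigid : forall X Y, M X -> M Y -> ext0 X Y.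
Hypothesis Mproj : forall P, projective P -> M P.

(** For X >-> I ->> C with [I] injective, E(-, X) is a quotient of Hom(-, C), so an approximation M0
    -> C gives a generator. The relations are the maps lifting to the middle term [T] of that
    generator, covered by an approximation M1 -> T. *)
Lemma ext_fun_coherent X : coherent (ext_fun X).
Proof.
have [I [C [a [b [Ii [d rd]]]]]] := hI X.
have [M0 [f0 [MM0 f0P]]] := Mcf C.
have [T [x [y rT]]] := real_ex (pull f0 d).
have [M1 [f1 [MM1 f1P]]] := Mcf T.
apply/coherentP; exists (exist _ M1 MM1), (exist _ M0 MM0), (qpi _ (y ∘ f1)), (pull f0 d).
apply: ext_presents.
- move=> N u MN; have [t ->] := push0_pull rd (Ii _ (push a u)).
  by have [h ->] := f0P N t MN; exists h; rewrite pullM.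
- move=> N t MN /(pull0_lift rT)[s ->].
  by have [r ->] := f1P N s MN; exists r; rewrite compA.
- by rewrite pullM (conf_pull0 rT) pullr0.
Qed.

Definition ext_ob X : cob (mod_cat A) := exist _ (ext_fun X) (ext_fun_coherent X).

Lemma ext_ob_dense (hP : enough_projectives B) (F : cob (mod_cat A)) :
  exists X (u : chom (ext_ob X) F), cat_iso u.
Proof.
have /coherentP[[M1 MM1] [[M0 MM0] [q [s pF]]]] := svalP F.
have [P [K [k [p [Pp [c rc]]]]]] := hP M0.
pose f : @hom B M1 M0 := repr q.
have [X [i [y rX]]] := real_ex (pull f c).
exists X; apply: presents_iso pF; rewrite -[q]qpi_repr.
apply: (@ext_presents X M1 M0 MM1 MM0 f (push i c)).
(* E(N, M1) = 0 brings [u] from E(N, K), and E(N, P) = 0 makes it a pullback of [c]. *)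
- move=> N u MN; have [e ->] := push_exact rX (Mrigid MN MM1 (push y u)).
  have [t ->] := push0_pull rc (Mrigid MN (Mproj Pp) (push k e)).
  by exists t; rewrite push_pull.
(* The kernel of [push i] consists of pullbacks of [pull f c]; hence [t] agrees with some [f ∘ r] up
   to a map through [P]. *)
- move=> N t MN; rewrite -push_pull => /(push0_pull rX)[r].
  rewrite -pullM => e; exists r.
  have [g eg] : exists g, t - f ∘ r = p ∘ g.
    by apply: (pull0_lift rc); rewrite pull_sub e subrr.
  apply/esym/qpi_eq/in_ideal_factors; rewrite eg.
  by exists P, p, g.
- by rewrite -push_pull (conf_push0 rX).
Qed.

(** * The induced functor on the stable category and on the heart *)

Section Stable.
Variables U V : ob B -> Prop.
Hypothesis cUV : cotorsion_pair U V.
Hypothesis MU : forall N, M N -> U N.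
Hypothesis MUext : forall N K, M N -> U K -> ext0 N K.
Hypothesis Mres : forall K, U K -> exists L M0 (k : hom L M0) (f : hom M0 K),
  [/\ U L, M M0 & conflation k f].
Local Notation W := (W_of U V).

Lemma push_qpi (N X Y : ob B) (f g : hom X Y) (e : EE N X) :
  M N -> qpi W f = qpi W g -> push f e = push g e.
Proof.
move=> MN /(qpi_eqW cUV)[W0 [h [k [[UW0 _] ehk]]]].
apply/eqP; rewrite -subr_eq0 -push_sub ehk pushM (MUext MN UW0 (push k e)).
by rewrite pushr0.
Qed.

Definition stable_ext_map (X Y : ob (stable U V)) (f : hom X Y) :
    chom (ext_ob X) (ext_ob Y) :=
  ext_trans (repr f : @hom B X Y).

Lemma stable_ext_map_qpi X Y (f : hom X Y) : stable_ext_map (qpi W f) = ext_trans f.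
Proof.
apply: abtrans_eq => N s; apply: push_qpi; first exact: (svalP N).
by rewrite qpi_repr.
Qed.

Lemma stable_ext_map1 (X : ob (stable U V)) : stable_ext_map (idm X) = cid (ext_ob X).
Proof.
rewrite -[idm X]/(qpi W (@idm B X)) stable_ext_map_qpi.
by apply: abtrans_eq => N s; apply: push1.
Qed.

Lemma stable_ext_mapM (X Y Z : ob (stable U V)) (g : hom Y Z) (f : hom X Y) :
  stable_ext_map (g ∘ f) = ccomp (stable_ext_map g) (stable_ext_map f).
Proof.
rewrite -[g ∘ f]/(qpi W ((repr g : @hom B Y Z) ∘ repr f)) stable_ext_map_qpi.
by apply: abtrans_eq => N s; apply: pushM.
Qed.

Definition stable_ext : functor (stable U V) (mod_cat A) :=
  @Functor (stable U V) (mod_cat A) ext_ob stable_ext_map stable_ext_map1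
    (fun _ _ _ g f => stable_ext_mapM g f).

(** Extensions from [M] to [U] vanish: with U0 this gives surjectivity, and injectivity with the
    object K of [reflection_class]. *)
Lemma reflection_ext_iso X Z U0 (z : hom X Z) (u : hom Z U0) :
  reflection_sequence U V z u -> cat_iso (ext_trans z : chom (ext_ob X) (ext_ob Z)).
Proof.
move=> rzu; have [_ UU0 [d rd] _] := rzu; apply: bijective_mod_iso => -[N MN] /= e.
  move=> /(push0_pull rd)[t ->].
  have [K [k [c [UK ->]]]] := reflection_class cUV rzu rd.
  by rewrite -push_pull (MUext MN UK (pull t c)) pushr0.
have [e' ->] := push_exact rd (MUext MN UU0 (push u e)).
by exists e'.
Qed.

Lemma coreflection_ext_iso X Y V0 (v : hom V0 X) (x : hom X Y) :
  coreflection_sequence U V v x -> cat_iso (ext_trans x : chom (ext_ob X) (ext_ob Y)).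
Proof.
case=> _ VV0 [d rd] surj; apply: bijective_mod_iso => -[N MN] /= e; last first.
  exact: surj (MU MN) e.
move=> /(push_exact rd)[e' ->].
by rewrite (cp_ext0 cUV e' (MU MN) VV0) pushr0.
Qed.

(** The isomorphisms are the images of [p] and [m]; their naturality is the equation characterizing
    sigma^+ and sigma^- on morphisms. *)
Lemma ext_heart_functor H : @heart_functor B U V H ->
  nat_iso (fcomp stable_ext (fcomp (@fullsub_incl (stable U V) (heart_ob U V)) H))
    (fcomp stable_ext (quotient_fun W)).
Proof.
case=> Sp [p [Sm [m [sp sm ->]]]].
have isoP : nat_iso (fcomp stable_ext (quotient_fun W))
    (fcomp stable_ext (fcomp (@fullsub_incl (stable U V) (Bplus U V)) (fcomp Sp (quotient_fun W)))).
  exists (fun X => fun_map stable_ext (qpi W (p X) : @hom (stable U V) X (sval (Sp X)))).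
  split=> [X|X Y f].
    have [U0 [u zu]] := sp_seq sp X.
    rewrite -[fun_map _ _]/(stable_ext_map _) stable_ext_map_qpi.
    exact: reflection_ext_iso zu.
  have e := (sp_map sp (qpi W f : @hom (stable U V) X Y)).1.
  apply: etrans (esym (fun_mapM stable_ext _ _)) _.
  apply: etrans (fun_mapM stable_ext _ _).
  exact: (congr1 (fun g => fun_map stable_ext g) (esym e)).
have isoM : nat_iso (fcomp stable_ext (fcomp (@fullsub_incl (stable U V) (Bminus U V)) Sm))
    stable_ext.
  exists (fun X => fun_map stable_ext (qpi W (m X) : @hom (stable U V) (sval (Sm X)) X)).
  split=> [X|X Y f].
    have [V0 [v vx]] := sm_seq sm X.
    rewrite -[fun_map _ _]/(stable_ext_map _) stable_ext_map_qpi.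
    exact: coreflection_ext_iso vx.
  have e := (sm_map sm f).1.
  apply: etrans (esym (fun_mapM stable_ext _ _)) _.
  apply: etrans (fun_mapM stable_ext _ _).
  exact: (congr1 (fun g => fun_map stable_ext g) e).
apply: nat_iso_trans (nat_iso_sym isoP).
exact: nat_iso_whiskerr isoM.
Qed.

(** As [e] dies on M0, it is pushed out along some L -> Y; since [L] is in [U], this map passes
    through an object of [V]. *)
Lemma Bplus_detect U0 Y (e : EE U0 Y) : U U0 -> Bplus U V Y ->
  (forall N (t : hom N U0), M N -> pull t e = 0) -> e = 0.
Proof.
move=> UU0 BY e0; have [L [M0 [k [f [UL MM0 [c rc]]]]]] := Mres UU0.
have [g ->] := pull0_push rc (e0 M0 f MM0).
have [W0 [h [h' [[_ VW0] ->]]]] := Bplus_factor cUV g UL BY.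
by rewrite pushM (cp_ext0 cUV (push h' c) UU0 VW0) pushr0.
Qed.

Lemma heart_faithful X Y (f : hom X Y) : Bminus U V X -> Bplus U V Y ->
  (forall N (e : EE N X), M N -> push f e = 0) -> factors W f.
Proof.
move=> [W0 [U0 [a [b [WW0 UU0 [d rd]]]]]] BY f0.
have [g ->] : exists g, f = g ∘ a.
  apply: (push0_extend rd); apply: Bplus_detect => // N t MN.
  by rewrite -push_pull; apply: f0.
by exists W0, g, a.
Qed.

Lemma heart_full X Y (th : abtrans (ext_fun X) (ext_fun Y)) :
  Bminus U V X -> Bplus U V Y -> exists f : hom X Y, th = ext_trans f.
Proof.
move=> [W0 [U0 [a [b [WW0 UU0 [d rd]]]]]] BY.
have thN N N' (MN : M N) (MN' : M N') (t : hom N N') e :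
    th (exist _ N MN) (pull t e) = pull t (th (exist _ N' MN') e).
  have := @at_nat _ _ _ th (exist _ N MN) (exist _ N' MN') (qpi (@projective B) t) e.
  by rewrite /= /ext_map !pull_repr.
have th0 N : th N 0 = 0 by apply: (addrI (th N 0)); rewrite -at_compD !addr0.
have [L [M0 [k [f0 [UL MM0 [c rc]]]]]] := Mres UU0.
have [T [u1 [v2 [u2 [v1 [r1 r2 _]]]]]] := pullback_conf rd rc.
have UT : U T := cp_U_ext cUV (ex_intro _ _ r2 : conflation u2 v1) UL WW0.1.
pose d0 : ext_fun X (exist _ M0 MM0) := pull f0 d.
(* [T] is the middle term of the generator [d0], so [d0] dies on [T]. By naturality its image under
   [th] dies on every map from [M] to [T], hence on [T], and is therefore a pushout of [d0]. *)
have [f ef] : exists f, th _ d0 = push f (pull f0 d).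
  apply: (pull0_push r1); apply: Bplus_detect => // N t MN.
  rewrite -pullM -thN pullM /d0 (conf_pull0 r1) pullr0.
  exact: (th0 (exist _ N MN)).
exists f; apply: abtrans_eq => -[N MN] /= e.
(* [d0] generates: [e] is a pullback of [d] because E(N, W0) = 0, and the map lifts to M0 because
   E(N, L) = 0. *)
have [t ->] := push0_pull rd (MUext MN WW0.1 (push a e)).
have [s ->] := pull0_lift rc (MUext MN UL (pull t c)).
by rewrite pullM (thN _ _ _ MM0) push_pull -ef.
Qed.

Definition heart_ext : functor (heart U V) (mod_cat A) :=
  fcomp stable_ext (@fullsub_incl (stable U V) (heart_ob U V)).

Lemma heart_ext_equivalence : enough_projectives B -> is_equivalence heart_ext.
Proof.
move=> hP; apply: ff_dense_equivalence.
- move=> [X [BpX BmX]] [Y [BpY BmY]] f g /= e.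
  rewrite -[f]qpi_repr -[g]qpi_repr; apply/(qpi_eqW cUV)/heart_faithful => // N s MN.
  rewrite push_sub; apply/eqP; rewrite subr_eq0; apply/eqP.
  exact: (congr1 (fun t : abtrans (ext_fun X) (ext_fun Y) => t (exist _ N MN) s) e).
- move=> [X [BpX BmX]] [Y [BpY BmY]] th; have [f ->] := heart_full th BmX BpY.
  by exists (qpi W f); apply: stable_ext_map_qpi.
(* [X] need not lie in the heart; [H X] does and has the same image. *)
move=> F; have [X [u iu]] := ext_ob_dense hP F.
have [H hH] := heart_functor_ex cUV.
have [eta [ieta _]] := ext_heart_functor hH.
by exists (H X), (ccomp u (eta X)); apply: cat_iso_comp iu (ieta X).
Qed.
End Stable.

(** On [B] itself both sides are E(-, X) restricted to [M]; this common functor links the different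
    hearts. *)
Lemma stable_ext_quotient U V U' V' (cUV : cotorsion_pair U V) (cUV' : cotorsion_pair U' V')
    (e : forall N K, M N -> U K -> ext0 N K) (e' : forall N K, M N -> U' K -> ext0 N K) :
  nat_iso (fcomp (stable_ext cUV e) (quotient_fun (W_of U V)))
    (fcomp (stable_ext cUV' e') (quotient_fun (W_of U' V'))).
Proof.
exists (fun X => cid (ext_ob X)); split=> [X|X Y f].
  by exists (cid _); rewrite ccomp1f.
rewrite ccomp1f ccompf1 /=.
by rewrite !stable_ext_map_qpi.
Qed.
End ExtFunctor.

(** * The hearts of the pairs (M_l, Y_l) *)

(** For l = 1 the resolution is trivial, with kernel zero; otherwise the defining cone has its
    kernel in M_{l-1}, which is contained in M_l. *)
Lemma M_sub_resolution (B : extriangulated) (hP : enough_projectives B)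
    (Sig : nat -> ob B -> ob B) (hSig : cosyzygy_choice Sig) m (M : ob B -> Prop)
    (m_gt0 : (0 < m)%N) (hM : cluster_tilting Sig m.+1 M) l (K : ob B) :
  (1 <= l <= m)%N -> M_sub M l K ->
  exists L M0 (k : hom L M0) (f : hom M0 K), [/\ M_sub M l L, M M0 & conflation k f].
Proof.
case: l => // -[|i] /= im MK.
  exists zob, K, 0, (idm K); split=> //; last by exists 0; apply: realizes_0id.
  by apply: (ct_projective hM) => C d; rewrite -[d]pull1 zobP pull0.
case: MK => L [M0 [k [f [ML MM0 kf]]]]; exists L, M0, k, f; split=> //.
by apply: (M_sub_le hP hSig m_gt0 hM _ ML); rewrite leqnSn ltnW.
Qed.

Theorem corollary5p15 (B : extriangulated)
    (hP : enough_projectives B) (hI : enough_injectives B)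
    (Sig : nat -> ob B -> ob B) (hSig : cosyzygy_choice Sig)
    (n : nat) (hn : (2 <= n)%N)
    (M : ob B -> Prop) (hM : cluster_tilting Sig n M) :
  [/\ forall l : nat, (1 <= l <= n - 1)%N ->
        cotorsion_pair (M_sub M l) (Y_sub M n l),
      forall l l' : nat, (1 <= l <= n - 1)%N -> (1 <= l' <= n - 1)%N ->
        heart_equivalent (M_sub M l) (Y_sub M n l) (M_sub M l') (Y_sub M n l')
    & forall l : nat, (1 <= l <= n - 1)%N ->
        equivalent (heart (M_sub M l) (Y_sub M n l))
                   (mod_cat (subquotient M (@projective B)))].
Proof.
case: n hn hM => // m m_gt0 hM; rewrite subn1 /=.
have cY l (hl : (1 <= l <= m)%N) := M_Y_cotorsion hP hI hSig m_gt0 hM hl.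
have ext l : (1 <= l <= m)%N -> forall N K, M N -> M_sub M l K -> ext0 N K.
  case: l => // i /= im N K MN /(M_subP hP hSig m_gt0 hM _ (ltnW im)) HK.
  by apply/(van0 hSig)/HK; rewrite // subn_gt0.
have MU l : (1 <= l <= m)%N -> forall N, M N -> M_sub M l N.
  case: l => // i /= im N MN.
  by apply: (@M_sub_le _ hP _ hSig _ m_gt0 _ hM 0 i); rewrite //= ltnW.
have res l hl K := @M_sub_resolution B hP Sig hSig m M m_gt0 hM l K hl.
have rigid := ct_rigid hSig m_gt0 hM; have proj := ct_projective hM.
have eqv l (hl : (1 <= l <= m)%N) :=
  heart_ext_equivalence hI (ct_contra hM) rigid proj (cY l hl) (MU l hl) (ext l hl) (res l hl) hP.
split=> // [l l' hl hl'|l hl]; last by exists (heart_ext hI (ct_contra hM) (cY l hl) (ext l hl)).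
split; [exact: heart_functor_ex (cY l hl) | exact: heart_functor_ex (cY l' hl') |].
(* The equivalence sought goes from the first heart to the coherent functors and back to the second
   heart by the quasi-inverse [G]. *)
move=> H H' hH hH'; have [G [GF FG]] := eqv l' hl'.
exists (fcomp G (heart_ext hI (ct_contra hM) (cY l hl) (ext l hl))); split.
  apply: equivalence_comp (eqv l hl) _.
  by exists (heart_ext hI (ct_contra hM) (cY l' hl') (ext l' hl')).
(* [H] and [H'] have isomorphic images in the coherent functors, both being E(-, X) restricted to
   [M]. *)
have iso := nat_iso_trans (ext_heart_functor hI (ct_contra hM) (cY l hl) (MU l hl) (ext l hl) hH)
  (nat_iso_trans (stable_ext_quotient hI (ct_contra hM) (cY l hl) (cY l' hl')
    (ext l hl) (ext l' hl'))
    (nat_iso_sym (ext_heart_functor hI (ct_contra hM) (cY l' hl') (MU l' hl') (ext l' hl') hH'))).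
apply: nat_iso_trans (nat_iso_whiskerl G iso) _.
exact: nat_iso_whiskerr H' GF.
Qed.
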